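(* Let $\alpha\in(0,2)$, $\alpha\ne 1$, let $W_j\sim\mathcal{N}(0,\sigma_W^2)$ with $\sigma_W>0$, and let $c>1$. With $a=\alpha/2$, $\eta=(1-a)/a$, $g$, $K(a)$ and $Z_{(c,\infty)}$ as in the context and $Z\sim\mathcal{N}(0,1)$, for any $\delta\in(0,2)$, $$\Delta(Z_{(c,\infty)},Z)\le B_2(c,\alpha,\delta):=\frac{9.6\sqrt\eta}{\pi\sqrt{2(2-\delta)c}}+B_3(c,\alpha,\delta),$$ where $$B_3(c,\alpha,\delta):=\frac{K(a)}{c}\left(\frac{c(2-\delta)}{(c-1)g(2-\delta)}\right)^2\left\{1-\left[1-g(2-\delta)(c-1)\right]\exp\big(g(2-\delta)(c-1)\big)\right\}$$ is an $O(1/c)$ term (as $c\to\infty$), and $\Delta(Z_{(c,\infty)},Z):=\sup_{x\in\mathbb{R}}|\mathbb{P}(Z_{(c,\infty)}\le x)-\mathbb{P}(Z\le x)|$.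
   Context: Lower incomplete gamma function: $\gamma(s,x)=\int_0^x t^{s-1}e^{-t}\,dt$. Set $a=\alpha/2$, $\eta=(1-a)/a$, $g(w):=1-e^{-w}-w^a\gamma(1-a,w)$ for $w\ge0$, and $$K(a):=\frac1\pi\left[\frac{a}{2(2-a)}+\frac1{\eta^2}\right].$$ Let $\{\Gamma_j\}_{j\ge1}$ be the successive arrival times of a unit rate Poisson process on $(0,\infty)$ and let $\{W_j\}_{j\ge1}$ be i.i.d. $\mathcal{N}(0,\sigma_W^2)$ independent of $\{\Gamma_j\}$. For $c>0$, $R_{(c,\infty)}$ is the limit in distribution, as $d\to\infty$, of $R_{(c,d)}:=\sum_{j:\Gamma_j\in(c,d)}W_j\Gamma_j^{-1/\alpha}$ (this limit exists); $S^2_{(c,\infty)}:=\sigma_W^2\frac{\alpha}{2-\alpha}c^{(\alpha-2)/\alpha}$; and $Z_{(c,\infty)}:=R_{(c,\infty)}/S_{(c,\infty)}$. *)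

(* Defs.v *)
From HB Require Import structures.
From mathcomp Require Import all_boot all_order all_algebra finmap.
From mathcomp Require Import all_classical all_reals all_analysis.
From mathcomp Require Import measurable_realfun.

Set Implicit Arguments.
Unset Strict Implicit.
Unset Printing Implicit Defensive.

Import Order.TTheory GRing.Theory Num.Theory.
Import numFieldNormedType.Exports.

Local Open Scope classical_set_scope.
Local Open Scope ring_scope.

Section independence.
Context d (T : measurableType d) (R : realType) (P : probability T R).

Definition mutually_independent (I : choiceType) d' (T' : measurableType d')
    (X : I -> T -> T') : Prop :=
  forall (J : {fset I}) (A : I -> set T'),
    (forall i, measurable (A i)) ->
    P (\bigcap_(i in [set` J]) X i @^-1` A i) =
      (\prod_(i <- J) P (X i @^-1` A i))%E.

Definition generated_sigma_algebra (I : Type) d' (T' : measurableType d')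
    (X : I -> T -> T') : set (set T) :=
  <<s \bigcup_i preimage_set_system [set: T] (X i) measurable >>.

Definition independent_families (I J : Type)
    d1 (T1 : measurableType d1) d2 (T2 : measurableType d2)
    (X : I -> T -> T1) (Y : J -> T -> T2) : Prop :=
  forall A B, generated_sigma_algebra X A -> generated_sigma_algebra Y B ->
    P (A `&` B) = (P A * P B)%E.

End independence.

Section laws.
Context d (T : measurableType d) (R : realType) (P : probability T R).

(* The laws are compared on measurable sets only: a measure is a function on
   all sets, whose values on non-measurable ones are meaningless. The second
   parameter of [normal_prob] is the standard deviation. *)
Definition normally_distributed (X : {RV P >-> R}) (m s : R) : Prop :=
  forall A : set R, measurable A -> distribution P X A = normal_prob m s A.

(* [N t] counts the points in ]0, t]; only the values at t >= 0 matter. *)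
Definition poisson_process (rate : R) (N : R -> {RV P >-> nat}) : Prop :=
  [/\ {ae P, forall w, N 0 w = 0%N /\
        forall s t, 0 <= s -> s <= t -> (N s w <= N t w)%N},
      (forall s t, 0 <= s -> s < t -> forall k : nat,
        P [set w | (N t w - N s w)%N = k] =
          (poisson_pmf (rate * (t - s)) k)%:E) &
      (forall t : nat -> R, 0 <= t 0%N -> nondecreasing_seq t ->
        mutually_independent P
          (fun i w => (N (t i.+1) w - N (t i) w)%N))].

(* [Gamma j] is the (j+1)-st arrival time: it has occurred by time t iff at
   least j+1 points have been counted by then. As N 0 = 0, arrival times are
   positive; the equivalence also forces N to be right-continuous. *)
Definition poisson_arrival_times (rate : R) (Gamma : nat -> {RV P >-> R}) :
    Prop :=
  exists N : R -> {RV P >-> nat}, poisson_process rate N /\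
    {ae P, forall w, forall (j : nat) (t : R), 0 <= t ->
      (Gamma j w <= t) = (j < N t w)%N}.

End laws.

Definition cvg_in_distribution d (T : measurableType d) d' (T' : measurableType d')
    (R : realType) (P : probability T R) (P' : probability T' R)
    (X : R -> {RV P >-> R}) (Y : {RV P' >-> R}) : Prop :=
  forall x : R, {for x, continuous (cdf Y)} ->
    cdf (X t) x @[t --> +oo%R] --> cdf Y x.

Definition kolmogorov_distance d (T : measurableType d) d' (T' : measurableType d')
    (R : realType) (P : probability T R) (P' : probability T' R)
    (X : {RV P >-> R}) (Y : {RV P' >-> R}) : \bar R :=
  ereal_sup [set (`| cdf X x - cdf Y x |)%E | x in [set: R]].

Section window_sum.
Context d (T : measurableType d) (R : realType).
Variables (alpha : R) (W Gamma : nat -> {mfun T >-> R}).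

(* The finitely supported sum [\sum_(j \in _)] is 0 when there are infinitely
   many nonzero terms; only finitely many arrival times lie in ]u, v[ almost
   surely. *)
Definition window_sum (u v : R) (w : T) : R :=
  \sum_(j \in [set j | u < Gamma j w < v]) W j w * Gamma j w `^ (- alpha^-1).

Let term (u v : R) (j : nat) (w : T) : R :=
  if u < Gamma j w < v then W j w * Gamma j w `^ (- alpha^-1) else 0.

Let measurable_term u v j : measurable_fun setT (term u v j).
Proof.
apply: measurable_fun_ifT => //.
  apply: measurable_and => /=; exact: measurable_fun_ltr.
apply: measurable_funM => //.
by apply: (measurableT_comp (measurable_powR _)).
Qed.

Lemma measurable_window_sum u v : measurable_fun setT (window_sum u v).
Proof.
pose Z n := \bigcap_(j in [set j | (n <= j)%N]) (term u v j @^-1` [set 0]).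
have mZ n : measurable (Z n).
  apply: bigcap_measurable; first by exists n => /=.
  move=> j _; rewrite -[X in measurable X]setTI.
  exact: measurable_term.
have mZU : measurable (\bigcup_n Z n) by exact: bigcup_measurable.
pose h n w := \1_(\bigcup_n Z n) w * \sum_(0 <= j < n) term u v j w.
apply: (@measurable_fun_cvg _ _ _ setT h).
  move=> n; apply: measurable_funM; first exact: measurable_indic.
  exact: measurable_sum.
move=> w _; rewrite /h indicE.
have -> : window_sum u v w = \sum_(j \in [set: nat]) term u v j w.
  rewrite /window_sum fsbig_mkcond; apply: eq_fsbigr => j _.
  by rewrite /patch /term mem_setE.
have supp0 n j : Z n w -> (n <= j)%N -> term u v j w = 0 by move=> Zn /Zn.
have [|nZ] := boolP (w \in _).
  rewrite inE => -[n _ Zn]; apply: cvg_near_cst; near=> m.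
  rewrite mul1r /index_iota subn0 fsbig_seq ?iota_uniq//.
  apply: fsbig_widen => // j [_ /=].
  rewrite mem_iota add0n /= => /negP; rewrite -leqNgt => mj.
  apply: supp0 Zn _; apply: leq_trans mj.
  by near: m; exists n.
apply: cvg_near_cst; near=> m; rewrite mul0r fsbig_dflt// setTI => finS.
move/negP: nZ; apply; rewrite inE.
have [X SX] := finite_fsetP.1 finS.
exists (\max_(i <- X) i).+1 => // j /= nj; apply: contrapT => tj.
have : [set` X] j by rewrite -SX.
move=> /= jX; have := @leq_bigmax_seq _ (enum_fset X) xpredT id j jX isT.
by rewrite leqNgt nj.
Unshelve. all: by end_near. Qed.

HB.instance Definition _ (u v : R) :=
  isMeasurableFun.Build _ _ _ _ (window_sum u v) (measurable_window_sum u v).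

End window_sum.

(* Needed to write [f =O_ (+oo) g]. *)
Canonical pinfty_filterType (R : realType) :=
  FilterType (pinfty_nbhs R) _.

Section bounds.
Context (R : realType).
Implicit Types (a s x w c alpha delta sigma : R).

Definition lower_incomplete_gamma s x : R :=
  \int[lebesgue_measure]_(t in `[0, x]) (t `^ (s - 1) * expR (- t)).

Definition eta a : R := (1 - a) / a.

Definition g a w : R :=
  1 - expR (- w) - w `^ a * lower_incomplete_gamma (1 - a) w.

Definition K a : R := pi^-1 * (a / (2 * (2 - a)) + (eta a ^+ 2)^-1).

Definition B3 c alpha delta : R :=
  let a := alpha / 2 in
  let g0 := g a (2 - delta) in
  K a / c * (c * (2 - delta) / ((c - 1) * g0)) ^+ 2 *
    (1 - (1 - g0 * (c - 1)) * expR (g0 * (c - 1))).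

Definition B2 c alpha delta : R :=
  96 / 10 * Num.sqrt (eta (alpha / 2)) / (pi * Num.sqrt (2 * (2 - delta) * c))
    + B3 c alpha delta.

(* [S2_tail] is the variance of the limit of [window_sum c d] as d -> +oo. *)
Definition S2_tail sigma alpha c : R :=
  sigma ^+ 2 * (alpha / (2 - alpha)) * c `^ ((alpha - 2) / alpha).

Definition S_tail sigma alpha c : R := Num.sqrt (S2_tail sigma alpha c).

End bounds.

(* Main.v *)
(** Conditionally on the arrival times, the window sum is a centred Gaussian
with variance [sigma^2 V], where [V] is the sum of [Gamma_j^(-2/alpha)] over the
window.  As [|Phi(x/sqrt v) - Phi(x)| <= 3/2 |v - 1|], the Kolmogorov distance
to the normal law of variance [sigma^2 m] is at most [3/2 E|V/m - 1|], hence at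
most [3/2 sqrt(Var V) / m] for [m = E V].  The mean and the variance of [V] come
from bracketing it by Riemann sums of independent Poisson increments, and on
[(c, +oo)] the bound equals [3/2 sqrt(eta (2-alpha)/(4-alpha)) / sqrt c], which
is below the first term of [B2] because [pi <= 4].  No smoothing inequality is
used, and [B3 >= 0] is simply slack, since [(1 - x) e^x <= 1]. *)

From HB Require Import structures.
Require Import Defs.
From mathcomp Require Import all_boot all_order all_algebra finmap.
From mathcomp Require Import all_classical all_reals all_analysis.
From mathcomp Require Import measurable_realfun.
From mathcomp Require Import ring lra.

Import Order.TTheory GRing.Theory Num.Theory.
Import numFieldNormedType.Exports.

Local Open Scope classical_set_scope.
Local Open Scope ring_scope.

Set Implicit Arguments.
Unset Strict Implicit.
Unset Printing Implicit Defensive.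

(** * The remainder term B3 *)

(** The law of an individual [Gamma j] is never written down: the arrival times are tied to a
    counting process with independent Poisson increments. This is why V is squeezed between two
    weighted sums of increments, whose first two moments are explicit. Conditioning is done by
    Tonelli, with the weights frozen at the observed arrival times; it needs a deterministic number
    of summands, so the window sum is cut at an index n that the arrivals in the window exceed with
    small probability. [Rc] may live on another probability space and is known only as a limit in
    distribution. Finite windows are therefore all compared with one fixed normal law, that of the
    infinite window, and only the resulting inequality between distribution functions passes to the
    limit. With p = 2/alpha, the mean of V on the infinite window is of order c^(1-p) and its
    variance of order c^(1-2p), so that sqrt(Var V) / E V is of order c^(-1/2) for every alpha. *)

Lemma integrable_powRN (R : realType) (a w : R) : 0 < a -> a < 1 -> 0 < w ->
  lebesgue_measure.-integrable `[0, w] (fun t : R => (t `^ (- a))%:E).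
Proof.
move=> a0 a1 w0.
(* Dividing by n + 2 keeps [[x n, w]] nondegenerate already for n = 0, as the fundamental theorem of
   calculus requires. *)
pose x n : R := w / n.+2%:R.
have x0 n : 0 < x n by rewrite divr_gt0.
have xw n : x n < w by rewrite ltr_pdivrMr// ltr_pMr// ltr1n.
have mf D : measurable D -> measurable_fun D (fun t : R => (t `^ (- a))%:E).
  by move=> mD; apply/measurable_EFinP; apply: measurable_funTS; exact: measurable_powR.
apply/integrableP; split; first exact: mf.
under eq_integral do rewrite /= ger0_norm ?powR_ge0//.
rewrite -integral_itv_obnd_cbnd; last exact: mf.
have -> : (`]0, w] = \bigcup_n `[x n, w])%classic.
  apply/seteqP; split=> t /=; rewrite in_itv/=.
    move=> /andP[t0 tw]; exists (Num.truncn (w / t)) => //=; rewrite in_itv/= tw andbT.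
    rewrite /x ler_pdivrMr// -ler_pdivrMl// mulrC.
    by rewrite (le_trans (ltW (truncnS_gt _)))// ler_nat.
  by move=> [n _] /=; rewrite in_itv/= => /andP[+ ->]; rewrite andbT; exact: lt_le_trans.
have ndF : nondecreasing_seq (fun n => `[x n, w]%classic).
  move=> n m nm; apply/subsetPset => t /=; rewrite !in_itv/= => /andP[+ ->].
  rewrite andbT; apply: le_trans; rewrite /x ler_pM2l// lef_pV2 ?posrE//.
  by rewrite ler_nat.
have cvgI : (\int[lebesgue_measure]_(t in `[x i, w]) (t `^ (- a))%:E @[i --> \oo] -->
    \int[lebesgue_measure]_(t in \bigcup_i `[x i, w]%classic) (t `^ (- a))%:E)%E.
  apply: ge0_nondecreasing_set_cvg_integral => // n.
    exact: mf.
  by move=> t _; rewrite lee_fin powR_ge0.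
pose F (t : R) : R := (1 - a)^-1 * t `^ (1 - a).
apply: (@le_lt_trans _ _ (F w)%:E); last exact: ltry.
rewrite -(cvg_lim _ cvgI)//; apply: lime_le; first by apply/cvg_ex; eexists; exact: cvgI.
apply: nearW => n.
have dF (t : R) : 0 < t -> is_derive t 1 F (t `^ (- a)).
  move=> t0; rewrite /F.
  have -> : t `^ (- a) = (1 - a)^-1 *: ((1 - a) * t `^ (1 - a - 1)).
    by rewrite /GRing.scale/= mulrA mulVf ?mul1r; [congr (_ `^ _); ring|lra].
  apply: is_deriveZ; exact: is_derive1_powR.
have cf (t : R) : 0 < t -> {for t, continuous (fun t : R => t `^ (- a))}.
  move=> t0; apply: differentiable_continuous; apply/derivable1_diffP.
  by apply: derivable_powR; rewrite in_itv/= andbT.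
have cF (t : R) : 0 < t -> {for t, continuous F}.
  move=> t0; apply: differentiable_continuous; apply/derivable1_diffP.
  by case: (dF t t0).
have gt0 (t : R) : t \in `[x n, w] -> 0 < t.
  by rewrite in_itv/= => /andP[+ _]; exact: lt_le_trans.
rewrite (@continuous_FTC2 _ _ F _ _ (xw n)).
- rewrite -EFinB lee_fin gerBl /F mulr_ge0 ?powR_ge0// invr_ge0; lra.
- apply: continuous_in_subspaceT => t; rewrite inE => /gt0; exact: cf.
- split.
  + by move=> t /subset_itv_oo_cc/gt0/dF[].
  + by apply: cvg_at_right_filter; apply: cF.
  + by apply: cvg_at_left_filter; apply: cF.
- move=> t /subset_itv_oo_cc/gt0 t0; rewrite derive1E.
  by have /@derive_val := dF t t0.
Qed.

Lemma integral_expRN (R : realType) (w : R) : 0 < w ->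
  (\int[lebesgue_measure]_(t in `[0%R, w]) (expR (- t))%:E = (1 - expR (- w))%:E)%E.
Proof.
move=> w0.
have dF (t : R) : is_derive t 1 (fun t : R => - expR (- t)) (expR (- t)).
  have -> : expR (- t) = - (expR (- t) * (- 1)) by rewrite mulrN1 opprK.
  apply: is_deriveN; apply: is_derive1_comp.
have cN : continuous (fun t : R => expR (- t)).
  by move=> t; apply: continuous_comp; [exact: opp_continuous|exact: continuous_expR].
have cF : continuous (fun t : R => - expR (- t)).
  by move=> t; apply: cvgN; exact: cN.
rewrite (@continuous_FTC2 _ _ (fun t : R => - expR (- t)) _ _ w0).
- by rewrite -EFinB oppr0 expR0 opprK addrC.
- exact: continuous_subspaceT.
- split.
  + by move=> t _; case: (dF t).
  + by apply: cvg_at_right_filter; exact: cF.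
  + by apply: cvg_at_left_filter; exact: cF.
- by move=> t _; rewrite derive1E; have /@derive_val := dF t.
Qed.

(** Both terms are integrals over the same interval: 1 - e^(-w) is that of e^(-t), and w^a
    gamma(1-a, w) is that of (w/t)^a e^(-t), where (w/t)^a >= 1. *)
Lemma g_le0 (R : realType) (a w : R) : 0 < a -> a < 1 -> 0 < w -> g a w <= 0.
Proof.
move=> a0 a1 w0; rewrite /g subr_le0.
have mD : measurable `[0, w] by exact: measurable_itv.
have ipow := integrable_powRN a0 a1 w0.
have mexp : measurable_fun (`[0, w] : set R) (fun t : R => (expR (- t))%:E).
  by apply/measurable_EFinP; apply: measurable_funTS; exact: measurableT_comp.
have iexp : lebesgue_measure.-integrable `[0, w] (fun t : R => (expR (- t))%:E).
  apply/integrableP; split => //.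
  under eq_integral do rewrite /= ger0_norm ?expR_ge0//.
  by rewrite integral_expRN// ltry.
have igam : lebesgue_measure.-integrable `[0, w]
    (fun t : R => (t `^ (1 - a - 1) * expR (- t))%:E).
  apply: le_integrable ipow => //.
    apply/measurable_EFinP; apply: measurable_funTS; apply: measurable_funM.
      exact: measurable_powR.
    exact: measurableT_comp.
  move=> t; rewrite /= in_itv/= => /andP[t0 _].
  rewrite lee_fin !ger0_norm ?mulr_ge0 ?powR_ge0 ?expR_ge0//.
  have -> : 1 - a - 1 = - a by ring.
  by rewrite ler_piMr ?powR_ge0// -expR0 ler_expR oppr_le0.
rewrite /lower_incomplete_gamma.
rewrite -(@RintegralZl _ _ _ lebesgue_measure)//.
have -> : 1 - expR (- w) = \int[lebesgue_measure]_(t in `[0, w]) expR (- t).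
  by rewrite /Rintegral integral_expRN.
have sub : [set` `]0, w]] `<=` [set` `[0, w]] by exact: subset_itv_oc_cc.
have igam' : lebesgue_measure.-integrable `[0, w]
    (fun t : R => (w `^ a * (t `^ (1 - a - 1) * expR (- t)))%:E).
  by apply: (integrableZl _ (w `^ a) igam).
have iexpS : lebesgue_measure.-integrable `]0, w] (fun t : R => (expR (- t))%:E).
  by apply: integrableS iexp => //; exact: sub.
have igamS : lebesgue_measure.-integrable `]0, w]
    (fun t : R => (w `^ a * (t `^ (1 - a - 1) * expR (- t)))%:E).
  by apply: integrableS igam' => //; exact: sub.
rewrite -(Rintegral_itv_obnd_cbnd iexpS) -(Rintegral_itv_obnd_cbnd igamS).
apply: le_Rintegral => //.
move=> t; rewrite /= in_itv/= => /andP[t0 tw].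
rewrite mulrA ler_peMl ?expR_ge0//.
have -> : 1 - a - 1 = - a by ring.
by rewrite powRN -ler_pdivrMr ?invr_gt0 ?powR_gt0// invrK mul1r ge0_ler_powR// ?nnegrE ltW.
Qed.

Lemma K_ge0 (R : realType) (a : R) : 0 < a -> a < 2 -> 0 <= K a.
Proof.
move=> a0 a2; rewrite /K mulr_ge0 ?invr_ge0 ?pi_ge0// addr_ge0//.
  by rewrite divr_ge0 ?ltW// mulr_gt0// subr_gt0.
by rewrite invr_ge0 sqr_ge0.
Qed.

Lemma onem_mulr_expR_le1 (R : realType) (x : R) : (1 - x) * expR x <= 1.
Proof.
rewrite -ler_pdivlMr ?expR_gt0// mul1r -expRN.
exact: expR_ge1Dx.
Qed.

Lemma B3_ge0 (R : realType) (c alpha delta : R) :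
  0 < c -> 0 < alpha -> alpha < 2 -> 0 <= B3 c alpha delta.
Proof.
move=> c0 al0 al2; have K0 : 0 <= K (alpha / 2) by apply: K_ge0; lra.
rewrite /B3 mulr_ge0//; first by rewrite mulr_ge0 ?sqr_ge0// divr_ge0// ltW.
by rewrite subr_ge0 onem_mulr_expR_le1.
Qed.

(** Since g <= 0, the exponent g0 (x - 1) is nonpositive and the factor in braces stays in [0, 1];
    what remains is K(a)/x times a bounded square. *)
Lemma B3_bigO (R : realType) (alpha delta : R) :
    0 < alpha -> alpha < 2 -> delta < 2 ->
  (fun x : R => B3 x alpha delta) =O_ (+oo%R) (fun x : R => x^-1).
Proof.
move=> al0 al2 de2; apply/eqO_exP.
set a := alpha / 2; set g0 := g a (2 - delta).
have a01 : 0 < a < 1 by apply/andP; split; rewrite /a; lra.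
have g0le : g0 <= 0 by apply: g_le0; lra.
(* The 2 bounds x / (x - 1) once x >= 2. The constant used is M + 1, because it has to be
   positive. *)
pose M := K a * (2 * (2 - delta) * g0^-1) ^+ 2.
have M0 : 0 <= M by rewrite mulr_ge0 ?sqr_ge0// K_ge0//; lra.
exists (M + 1); first by rewrite ltr_wpDl.
near=> x.
have x2 : 2 <= x by near: x; apply: nbhs_pinfty_ge; rewrite num_real.
rewrite !ger0_norm ?invr_ge0 ?B3_ge0//; try lra.
rewrite /B3 -/a -/g0.
set E := 1 - _.
have E1 : E <= 1.
  rewrite /E lerBlDr lerDl mulr_ge0 ?expR_ge0// subr_ge0.
  by rewrite (le_trans (mulr_le0_ge0 g0le _))//; lra.
have E0 : 0 <= E by rewrite subr_ge0 onem_mulr_expR_le1.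
have x1 : 0 < x - 1 by lra.
have -> : x * (2 - delta) / ((x - 1) * g0) = x / (x - 1) * ((2 - delta) * g0^-1).
  by rewrite invfM; ring.
have q : (x / (x - 1)) ^+ 2 <= 2 ^+ 2.
  by rewrite ler_pXn2r ?nnegrE ?divr_ge0//; [rewrite ler_pdivrMr//|..]; lra.
rewrite exprMn.
apply: (@le_trans _ _ (K a / x * (2 ^+ 2 * ((2 - delta) * g0^-1) ^+ 2) * 1)).
  have Kx : 0 <= K a / x by rewrite divr_ge0 ?K_ge0//; lra.
  apply: ler_pM => //; first by rewrite mulr_ge0// mulr_ge0 ?sqr_ge0.
  by rewrite ler_wpM2l// ler_wpM2r ?sqr_ge0.
rewrite (_ : _ * 1 = M / x); last by rewrite /M; ring.
by rewrite ler_wpM2r ?invr_ge0 ?lerDl//; lra.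
Unshelve. all: by end_near. Qed.

(** * Independent pairs *)

Section independent_pair.
Context d d1 d2 (T : measurableType d) (T1 : measurableType d1)
  (T2 : measurableType d2) (R : realType) (P : probability T R).
Variables (X : {mfun T >-> T1}) (Y : {mfun T >-> T2}).

Definition indep_pair := forall A B, measurable A -> measurable B ->
  P (X @^-1` A `&` Y @^-1` B) = (P (X @^-1` A) * P (Y @^-1` B))%E.

Let XY : {mfun T >-> (T1 * T2)%type} :=
  HB.pack (fun w => (X w, Y w)) (isMeasurableFun.Build _ _ _ _ (fun w => (X w, Y w))
    (measurable_fun_pair (measurable_funPT X) (measurable_funPT Y))).

(** The law of the pair agrees with the product of the marginals on rectangles, hence everywhere,
    and Tonelli applies. Averaging X with [Y w] frozen is the form that conditioning on Y takes
    below. *)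
Lemma indep_pair_integral (f : T1 * T2 -> \bar R) : indep_pair ->
    measurable_fun setT f -> (forall x, 0 <= f x)%E ->
  (\int[P]_w f (X w, Y w) = \int[P]_w \int[P]_v f (X v, Y w))%E.
Proof.
move=> XYi mf f0.
transitivity (\int[distribution P XY]_z f z)%E.
  by rewrite ge0_integral_distribution.
transitivity (\int[(distribution P X \x distribution P Y)%E]_z f z)%E.
  apply: eq_measure_integral => /= S mS _; apply/esym.
  exact: (@product_measure_unique _ _ _ _ _ (distribution P X)
    (distribution P Y) (distribution P XY) XYi _ mS).
rewrite fubini_tonelli1//.
rewrite (fubini_tonelli f mf f0) ge0_integral_distribution//; last 2 first.
- exact: measurable_fun_fubini_tonelli_G.
- by move=> y; exact: integral_ge0.
apply: eq_integral => w _ /=; rewrite ge0_integral_distribution//.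
exact: measurableT_comp.
Qed.

Lemma indep_pair_prob (S : set (T1 * T2)) : indep_pair -> measurable S ->
  P [set w | S (X w, Y w)] = (\int[P]_w P [set v | S (X v, Y w)])%E.
Proof.
move=> XYi mS.
have mXY w : measurable [set v | S (X v, Y w)].
  rewrite -[X in measurable X]setTI.
  exact: (measurableT_comp (pair2_measurable (Y w)) (measurable_funPT X)).
have mXYS : measurable [set w | S (X w, Y w)].
  rewrite -[X in measurable X]setTI.
  exact: (measurable_funPT XY).
transitivity (\int[P]_w (\1_S (X w, Y w))%:E)%E.
  by rewrite -(setIT [set w | _]) -integral_indic.
rewrite (indep_pair_integral (f := fun z => (\1_S z)%:E))//; last first.
  by apply/measurable_EFinP; exact: measurable_indic.
apply: eq_integral => w _.
by rewrite -(setIT [set v | _]) -integral_indic.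
Qed.

End independent_pair.

(** * Affine changes of variable for Lebesgue measure *)

Section lebesgue_affine.
Context (R : realType).
Local Notation mu := (@lebesgue_measure R).
Variables (b y : R).
Hypothesis b0 : 0 < b.

Let phi (x : measurableTypeR R) : measurableTypeR R := b * x + y.

Let mphi : measurable_fun setT phi.
Proof. by apply: measurable_funD => //; apply: measurable_funM. Qed.

(** The scaled image measure gives half-open intervals their length, which characterises Lebesgue
    measure. *)
Lemma lebesgue_measure_affine (A : set R) : measurable A ->
  mu A = (b%:E * mu [set x | A (b * x + y)%R])%E.
Proof.
move=> mA.
have b0' : 0 <= b by exact: ltW.
pose nu := mscale (NngNum b0') (pushforward mu phi).
rewrite (@lebesgue_measure_unique _ (nu mphi))//.
move=> X [[u v] _ <-] /=.
rewrite /nu /mscale/= /pushforward/=.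
have -> : phi @^-1` `]u, v] = `](u - y) / b, (v - y) / b]%classic.
  apply/seteqP; split=> x /=; rewrite /phi !in_itv/= ltr_pdivrMr//.
    by rewrite ler_pdivlMr// ltrBlDr lerBrDr mulrC.
  by rewrite ler_pdivlMr// ltrBlDr lerBrDr mulrC.
rewrite !lebesgue_measure_itv/= !lte_fin ltr_pM2r ?invr_gt0// ltrD2r.
case: ifP => _; rewrite ?mule0// -!EFinD -EFinM; congr EFin.
by field; rewrite gt_eqF.
Qed.

Lemma ge0_integral_affine (f : R -> \bar R) : measurable_fun setT f ->
  (forall x, 0 <= f x)%E ->
  (\int[mu]_x f x = b%:E * \int[mu]_x f (b * x + y)%R)%E.
Proof.
move=> mf f0.
have b0' : 0 <= b by exact: ltW.
pose nu := mscale (NngNum b0') (pushforward mu phi).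
transitivity (\int[nu mphi]_x f x)%E.
  apply: eq_measure_integral => A mA _; exact: lebesgue_measure_affine.
rewrite /nu ge0_integral_mscale//=.
by rewrite ge0_integral_pushforward.
Qed.

End lebesgue_affine.

(** * Normal laws *)

Section normal_law.
Context (R : realType).
Local Notation mu := (@lebesgue_measure R).
Implicit Types (m s t b x y : R) (A : set R).

(** The density is almost everywhere the Radon-Nikodym derivative, both having the same integral
    over every measurable set. Values in [0, 1] make f integrable, as the change of variables
    requires. *)
Lemma integral_normal_prob m s (f : R -> \bar R) : measurable_fun setT f ->
    (forall x, 0 <= f x <= 1)%E ->
  (\int[normal_prob m s]_x f x = \int[mu]_x (f x * (normal_pdf m s x)%:E))%E.
Proof.
move=> mf f01.
have intf : (normal_prob m s).-integrable setT f.
  apply: (@le_integrable _ _ _ (normal_prob m s) _ _ f (cst 1%E)) => //.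
    by move=> x _; have /andP[f0 f1] := f01 x; rewrite (gee0_abs f0) /cst gee0_abs.
  exact: finite_measure_integrable_cst.
rewrite -(Radon_Nikodym_change_of_variables (normal_prob_dominates m s))//=.
apply: ae_eq_integral => //.
- apply: emeasurable_funM => //; apply: (measurable_int mu).
  by apply: Radon_Nikodym_integrable; exact: normal_prob_dominates.
- apply: emeasurable_funM => //=; apply/measurableT_comp => //=.
  exact: measurable_normal_pdf.
- apply: ae_eqe_mul2l => /=.
  rewrite Radon_NikodymE//=; first exact: normal_prob_dominates.
  move=> dom; case: cid => /= h [h1 h2 h3].
  apply: integral_ae_eq => //=.
  + by apply/measurableT_comp =>//; exact: measurable_normal_pdf.
  + by move=> E E01 mE; rewrite -h3.
Qed.

Lemma normal_prob_indic m s A : normal_prob m s A =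
  (\int[mu]_x ((\1_A x)%:E * (normal_pdf m s x)%:E))%E.
Proof.
rewrite /normal_prob integral_mkcond; apply: eq_integral => x _.
by rewrite patchE indicE; case: ifPn => _; rewrite ?mul1e ?mul0e.
Qed.

Lemma normal_pdf_scale b s x : 0 < b -> 0 < s ->
  normal_pdf 0 s x = b * normal_pdf 0 (b * s) (b * x).
Proof.
move=> b0 s0; rewrite !normal_pdfE ?gt_eqF ?mulr_gt0// mulrA; congr (_ * expR _).
  rewrite /normal_peak (_ : (b * s) ^+ 2 * pi *+ 2 = b ^+ 2 * (s ^+ 2 * pi *+ 2)); last by ring.
  rewrite sqrtrM ?sqr_ge0// sqrtr_sqr gtr0_norm//.
  by rewrite invfM mulrA divff ?mul1r ?gt_eqF.
by field; rewrite !gt_eqF.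
Qed.

Lemma normal_prob_scale b s A : 0 < b -> 0 < s -> measurable A ->
  normal_prob 0 s [set x | A (b * x)] = normal_prob 0 (b * s) A.
Proof.
move=> b0 s0 mA; rewrite !normal_prob_indic.
rewrite [RHS](@ge0_integral_affine _ b 0)//; last 2 first.
- apply/measurable_EFinP; apply: measurable_funM; first exact: measurable_indic.
  exact: measurable_normal_pdf.
- by move=> x; rewrite lee_fin mulr_ge0// normal_pdf_ge0.
rewrite -ge0_integralZl//; last 3 first.
- apply/measurable_EFinP; apply: measurable_funM.
    by apply: measurableT_comp; [exact: measurable_indic|exact: measurable_funD].
  by apply: measurableT_comp; [exact: measurable_normal_pdf|exact: measurable_funD].
- by move=> x _; rewrite lee_fin mulr_ge0// normal_pdf_ge0.
- by rewrite lee_fin ltW.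
apply: eq_integral => x _; rewrite addr0 (normal_pdf_scale x b0 s0) !EFinM.
by rewrite muleCA; congr (_ * (_ * _))%E; rewrite !indicE.
Qed.

(** Completing the square: the joint density of the sum x and the summand y is the marginal density
    of x times the conditional density of y given x, itself normal. *)
Lemma normal_pdf_conv s t x y : 0 < s -> 0 < t ->
  let r := Num.sqrt (s ^+ 2 + t ^+ 2) in
  normal_pdf 0 s (x - y) * normal_pdf 0 t y =
  normal_pdf 0 r x * normal_pdf (x * t ^+ 2 / (s ^+ 2 + t ^+ 2)) (s * t / r) y.
Proof.
move=> s0 t0 r.
have r20 : 0 < s ^+ 2 + t ^+ 2 by rewrite addr_gt0// exprn_gt0.
have r0 : 0 < r by rewrite sqrtr_gt0.
have r2 : r ^+ 2 = s ^+ 2 + t ^+ 2 by rewrite sqr_sqrtr// ltW.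
rewrite !normal_pdfE ?gt_eqF ?divr_gt0 ?mulr_gt0//.
rewrite mulrACA [RHS]mulrACA -!expRD; congr (_ * expR _).
  rewrite /normal_peak -!invfM -!sqrtrM ?mulrn_wge0 ?mulr_ge0 ?sqr_ge0 ?pi_ge0
    ?(ltW s0) ?(ltW r0)//.
  congr (Num.sqrt _)^-1; rewrite !exprMn exprVn r2.
  by field; rewrite gt_eqF.
rewrite !exprMn exprVn r2.
by field; rewrite !gt_eqF.
Qed.

Lemma normal_prob_conv s t A : 0 < s -> 0 < t -> measurable A ->
  (\int[normal_prob 0 t]_y normal_prob 0 s [set x | A (x + y)%R])%E =
  normal_prob 0 (Num.sqrt (s ^+ 2 + t ^+ 2)) A.
Proof.
move=> s0 t0 mA; set r := Num.sqrt _.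
have r0 : 0 < r by rewrite sqrtr_gt0 addr_gt0// exprn_gt0.
have mS : measurable [set z : R * R | A (z.1 + z.2)].
  rewrite -[X in measurable X]setTI.
  by apply: (measurable_funD (f := fst) (g := snd)) => //.
have mf : measurable_fun setT (fun y => normal_prob 0 s [set x | A (x + y)]).
  rewrite (_ : (fun _ => _) = normal_prob 0 s \o ysection [set z : R * R | A (z.1 + z.2)]).
    exact: measurable_fun_ysection.
  by apply/funext => y /=; congr (normal_prob 0 s _); apply/seteqP; split => x;
    rewrite /ysection/= inE.
rewrite integral_normal_prob//; last first.
  move=> y; rewrite measure_ge0//=; apply: probability_le1.
  by rewrite -[X in measurable X]setTI; apply: measurable_funD.
(* Here x is the value of the sum. Integrating x first gives the left side after a shift by y;
   integrating y first leaves the marginal density of x, the conditional density having mass 1. *)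
pose H x y : R := \1_A x * (normal_pdf 0 s (x - y) * normal_pdf 0 t y).
have H0 x y : (0 <= (H x y)%:E)%E by rewrite lee_fin !mulr_ge0// normal_pdf_ge0.
have mH : measurable_fun setT (fun z : R * R => (H z.1 z.2)%:E).
  apply/measurable_EFinP; apply: measurable_funM.
    by apply: measurableT_comp => //; exact: measurable_indic.
  apply: measurable_funM.
    by apply: measurableT_comp; [exact: measurable_normal_pdf|exact: measurable_funB].
  by apply: measurableT_comp => //; exact: measurable_normal_pdf.
transitivity (\int[mu]_y \int[mu]_x (H x y)%:E)%E.
  apply: eq_integral => y _.
  rewrite [RHS](@ge0_integral_affine _ 1 y)//; last first.
    exact: (measurableT_comp mH (pair2_measurable y)).
  rewrite mul1e normal_prob_indic -ge0_integralZr//; last 3 first.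
  - apply/measurable_EFinP; apply: measurable_funM; last exact: measurable_normal_pdf.
    apply: measurable_indic.
    by rewrite -[X in measurable X]setTI; apply: measurable_funD.
  - by move=> x _; rewrite lee_fin mulr_ge0// normal_pdf_ge0.
  - by rewrite lee_fin normal_pdf_ge0.
  apply: eq_integral => x _.
  by rewrite /H mul1r addrK -!EFinM mulrA; congr ((_ * _ * _)%:E); rewrite !indicE.
transitivity (\int[mu]_x \int[mu]_y (H x y)%:E)%E.
  exact: (esym (@fubini_tonelli _ _ _ _ R mu mu _ mH (fun z => H0 z.1 z.2))).
rewrite normal_prob_indic; apply: eq_integral => x _.
under eq_integral do rewrite /H normal_pdf_conv// -/r mulrA EFinM.
rewrite ge0_integralZl//; last 3 first.
- by apply/measurable_EFinP; exact: measurable_normal_pdf.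
- by move=> y _; rewrite lee_fin normal_pdf_ge0.
- by rewrite lee_fin mulr_ge0// normal_pdf_ge0.
by rewrite integral_normal_pdf mule1 EFinM.
Qed.

End normal_law.

Section normal_sum.
Context d (T : measurableType d) (R : realType) (P : probability T R).

Lemma normal_law_add (X Y : {mfun T >-> R}) (s t : R) :
    0 < s -> 0 < t -> indep_pair P X Y ->
    (forall A, measurable A -> P (X @^-1` A) = normal_prob 0 s A) ->
    (forall A, measurable A -> P (Y @^-1` A) = normal_prob 0 t A) ->
  forall A, measurable A ->
    P [set w | A (X w + Y w)] = normal_prob 0 (Num.sqrt (s ^+ 2 + t ^+ 2)) A.
Proof.
move=> s0 t0 XYi Xs Yt A mA.
have mS : measurable [set z : R * R | A (z.1 + z.2)].
  rewrite -[X in measurable X]setTI.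
  by apply: (measurable_funD (f := fst) (g := snd)) => //.
have mtr (y : R) : measurable [set x | A (x + y)].
  by rewrite -[X in measurable X]setTI; apply: measurable_funD.
rewrite (indep_pair_prob XYi mS) /=.
under eq_integral do rewrite (Xs _ (mtr _)).
rewrite -normal_prob_conv//.
pose Y' : {mfun T >-> measurableTypeR R} := HB.pack (Y : T -> measurableTypeR R)
  (isMeasurableFun.Build _ _ _ (measurableTypeR R) Y (measurable_funPT Y)).
transitivity (\int[distribution P Y']_y normal_prob 0 s [set x | A (x + y)%R])%E.
  rewrite ge0_integral_distribution//.
  rewrite (_ : (fun _ => _) = normal_prob 0 s \o ysection [set z : R * R | A (z.1 + z.2)]).
    exact: measurable_fun_ysection.
  by apply/funext => y /=; congr (normal_prob 0 s _); apply/seteqP; split => x;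
    rewrite /ysection/= inE.
by apply: eq_measure_integral => B mB _; exact: Yt.
Qed.

(** Both E -> P(E and C) and E -> P(C) P(E) are finite measures; agreeing on a pi-system that
    contains the whole space, they agree on the sigma-algebra it generates. *)
Lemma indep_event_sigma_algebra (C : set T) (G : set (set T)) :
    measurable C -> (forall E, G E -> measurable E) -> G setT -> setI_closed G ->
    (forall E, G E -> P (E `&` C) = (P E * P C)%E) ->
  forall E, <<s G >> E -> P (E `&` C) = (P E * P C)%E.
Proof.
move=> mC mG GT GI GC E GE.
have PC0 : 0 <= fine (P C) by exact: fine_ge0.
have PCE : P C = (fine (P C))%:E by rewrite fineK// fin_num_measure.
pose m1 : {measure set T -> \bar R} := mrestr P mC.
pose m2 : {measure set T -> \bar R} := mscale (NngNum PC0) P.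
have m12 : m1 E = m2 E.
  apply: (@g_sigma_algebra_measure_unique _ _ _ G _ (fun=> setT)) => //.
  - by apply/seteqP; split => // x _; exists 0%N.
  - by move=> A GA; rewrite /m1 /m2/= /mrestr /mscale /= GC// muleC PCE.
  - move=> n; rewrite /m1/= /mrestr.
    by rewrite (le_lt_trans (probability_le1 _ _)) ?ltry//; exact: measurableI.
by move: m12; rewrite /m1 /m2/= /mrestr /mscale/= => ->; rewrite muleC -PCE.
Qed.

Variable W : nat -> {RV P >-> R}.

Definition lincomb (b : nat -> R) n (w : T) := \sum_(j < n) b j * W j w.

Lemma measurable_lincomb b n : measurable_fun setT (lincomb b n).
Proof. by apply: measurable_sum => j; exact: measurable_funM. Qed.

HB.instance Definition _ b n :=
  isMeasurableFun.Build _ _ _ _ (lincomb b n) (measurable_lincomb b n).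

Let G n := [set E | exists2 A : nat -> set R, (forall j, measurable (A j)) &
  E = \bigcap_(j in `I_n) (W j @^-1` A j)].

(** The cylinders [G n] over the first n variables form a pi-system. Independence from [W n] holds
    on them and extends to the generated sigma-algebra, for which the partial sum is measurable. *)
Lemma lincomb_indep b n : mutually_independent P (fun j => W j : T -> R) ->
  indep_pair P (lincomb b n) (W n).
Proof.
move=> Wi A B mA mB.
have mW j (C : set R) : measurable C -> measurable (W j @^-1` C).
  by move=> mC; rewrite -[X in measurable X]setTI; exact: measurable_funPT.
have GT : G n setT.
  by exists (fun=> setT) => //; apply/seteqP; split.
apply: (indep_event_sigma_algebra (G := G n)) => //.
- exact: mW.
- by move=> _ [D mD ->]; apply: bigcap_measurableType => j _; exact: mW.
- move=> _ _ [D mD ->] [D' mD' ->]; exists (fun j => D j `&` D' j).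
    by move=> j; exact: measurableI.
  by rewrite -bigcapI; apply: eq_bigcapr => j _; rewrite preimage_setI.
- move=> _ [D mD ->].
  (* Putting B at index n lets mutual independence over n + 1 indices treat the cylinder and the new
     event together. *)
  pose D' j := if j == n then B else D j.
  have mD' j : measurable (D' j) by rewrite /D'; case: ifP.
  pose K : {fset nat} := [fset j in iota 0 n]%fset.
  have nK : n \notin K by rewrite !inE mem_iota add0n ltnn.
  have KE : [set` K] = `I_n.
    by apply/seteqP; split => j /=; rewrite !inE mem_iota add0n.
  have capK : \bigcap_(i in [set` K]) W i @^-1` D' i = \bigcap_(j in `I_n) W j @^-1` D j.
    rewrite KE; apply: eq_bigcapr => j /= jn.
    by rewrite /D' ltn_eqF.
  have := Wi (n |` K)%fset D' mD'.
  rewrite big_fsetU1//= -(Wi K D' mD') capK.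
  have -> : \bigcap_(i in [set` (n |` K)%fset]) W i @^-1` D' i =
      \bigcap_(j in `I_n) W j @^-1` D j `&` W n @^-1` B.
    rewrite -capK; apply/seteqP; split => w.
      move=> h; split; last by have := h n; rewrite /= !inE eqxx /D' eqxx; apply.
      by move=> i /= iK; apply: h; rewrite /= !inE; move: iK; rewrite !inE => ->; rewrite orbT.
    move=> [h1 h2] i /=; rewrite !inE => /orP[/eqP ->|iK]; first by rewrite /D' eqxx.
    by apply: h1; rewrite /= !inE.
  by move=> ->; rewrite /D' eqxx muleC.
- suff m : measurable_fun (setT : set (g_sigma_algebraType (G n))) (lincomb b n).
    by have := m measurableT _ mA; rewrite setTI.
  apply: measurable_sum => j; apply: measurable_funM => // _ C mC.
  rewrite setTI; apply: sub_sigma_algebra.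
  exists (fun i => if i == j :> nat then C else setT); first by move=> i; case: ifP.
  apply/seteqP; split => w.
    by move=> Cw i _; rewrite /preimage/=; case: ifP => // /eqP ->.
  by move=> /(_ j (ltn_ord j)); rewrite /preimage/= eqxx.
Qed.

(** Induction by convolution. Convolution asks for two positive variances, so the cases where [b n]
    or all earlier coefficients vanish are treated apart; positivity of the total variance excludes
    the empty sum. *)
Lemma lincomb_normal (sigma : R) (b : nat -> R) n : 0 < sigma ->
    (forall j A, measurable A -> P (W j @^-1` A) = normal_prob 0 sigma A) ->
    mutually_independent P (fun j => W j : T -> R) ->
    (forall j, 0 <= b j) -> 0 < \sum_(j < n) b j ^+ 2 ->
  forall A, measurable A -> P (lincomb b n @^-1` A) =
    normal_prob 0 (sigma * Num.sqrt (\sum_(j < n) b j ^+ 2)) A.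
Proof.
move=> s0 Ws Wi b0; elim: n => [|n ih]; first by rewrite big_ord0 ltxx.
rewrite big_ord_recr/=.
have lE : lincomb b n.+1 = (fun w => lincomb b n w + b n * W n w).
  by apply/funext => w; rewrite /lincomb big_ord_recr.
have v0 : 0 <= \sum_(j < n) b j ^+ 2 by apply: sumr_ge0 => j _; exact: sqr_ge0.
have [bn0 vn A mA|bn0] := eqVneq (b n) 0.
  rewrite bn0 expr0n addr0 -ih//; last by move: vn; rewrite bn0 expr0n addr0.
  by congr (P _); apply/seteqP; split=> w; rewrite /preimage/= lE bn0 mul0r addr0.
have {}bn0 : 0 < b n by rewrite lt_neqAle eq_sym bn0/=.
have law_bW A : measurable A -> P [set w | A (b n * W n w)] = normal_prob 0 (b n * sigma) A.
  move=> mA; rewrite -normal_prob_scale// -(Ws n)//.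
  by rewrite -[X in measurable X]setTI; apply: measurable_funM.
have [vn _ A mA|vn _ A mA] := eqVneq (\sum_(j < n) b j ^+ 2) 0.
  rewrite vn add0r sqrtr_sqr gtr0_norm// mulrC -law_bW//.
  have l0 w : lincomb b n w = 0.
    rewrite /lincomb big1// => j _.
    have /eqP := vn; rewrite psumr_eq0; last by move=> i _; exact: sqr_ge0.
    by move/allP => /(_ j); rewrite mem_index_enum sqrf_eq0 => /(_ isT) /eqP ->; rewrite mul0r.
  by congr (P _); apply/seteqP; split=> w; rewrite /preimage/= lE l0 add0r.
have {}vn : 0 < \sum_(j < n) b j ^+ 2 by rewrite lt_neqAle eq_sym vn.
have mbW : measurable_fun setT (fun w => b n * W n w) by exact: measurable_funM.
pose Y : {mfun T >-> R} := HB.pack (fun w => b n * W n w)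
  (isMeasurableFun.Build _ _ _ _ (fun w => b n * W n w) mbW).
have XYi : indep_pair P (lincomb b n) Y.
  move=> A' B' mA' mB'.
  apply: (@lincomb_indep b n Wi A' [set x | B' (b n * x)] mA').
  by rewrite -[X in measurable X]setTI; apply: measurable_funM.
have := normal_law_add (mulr_gt0 s0 _) (mulr_gt0 bn0 s0) XYi (ih vn) law_bW mA.
rewrite sqrtr_gt0 => /(_ vn) e.
transitivity (P [set w | A (lincomb b n w + Y w)]).
  by congr (P _); apply/seteqP; split=> w; rewrite /preimage/= lE.
rewrite e; congr (normal_prob 0 _ A).
rewrite !exprMn sqr_sqrtr// -[in RHS](gtr0_norm s0) -sqrtr_sqr -sqrtrM ?sqr_ge0//.
by congr Num.sqrt; ring.
Qed.

End normal_sum.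

(** * Conditioning on the arrival times *)

Section conditioning.
Context d (T : measurableType d) (R : realType) (P : probability T R).
Variables (W Gamma : nat -> {RV P >-> R}).

Lemma generated_sigma_algebra_measurable (X : nat -> {RV P >-> R}) (E : set T) :
  generated_sigma_algebra (fun j => X j : T -> R) E -> measurable E.
Proof.
apply: smallest_sub; first exact: sigma_algebra_measurable.
by move=> _ [i _ [A mA <-]]; exact: measurable_funPT.
Qed.

(** The weights are frozen at w while the Gaussian variables are averaged over v. Measurability in w
    is part of the conclusion because this conditional probability is later compared with other
    functions under the integral. *)
Lemma indep_families_lincomb_prob (h : R -> R) n x : measurable_fun setT h ->
    independent_families P (fun j => W j : T -> R) (fun j => Gamma j : T -> R) ->
  measurable_fun setT
    (fun w => P [set v | (lincomb W (fun j => h (Gamma j w)) n v <= x)%R]) /\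
  P [set w | \sum_(j < n) h (Gamma j w) * W j w <= x] =
  (\int[P]_w P [set v | (lincomb W (fun j => h (Gamma j w)) n v <= x)%R])%E.
Proof.
move=> mh WGi.
(* The identity, viewed as a random element of [T] with the sigma-algebra
   generated by [W], is independent of the identity onto [T] with the one
   generated by [Gamma]. *)
pose sg (X : nat -> {RV P >-> R}) : measurableType _ := g_sigma_algebraType
  (\bigcup_i preimage_set_system [set: T] (X i : T -> R) measurable).
have mid (X : nat -> {RV P >-> R}) : measurable_fun setT (id : T -> sg X).
  by move=> _ E mE; rewrite setTI; exact: (generated_sigma_algebra_measurable mE).
have mX (X : nat -> {RV P >-> R}) j : measurable_fun setT (X j : sg X -> R).
  move=> _ A mA; apply: sub_sigma_algebra; exists j => //.
  by exists A.
pose iW : {mfun T >-> sg W} := HB.pack (id : T -> sg W)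
  (isMeasurableFun.Build _ _ _ _ (id : T -> sg W) (mid W)).
pose iG : {mfun T >-> sg Gamma} := HB.pack (id : T -> sg Gamma)
  (isMeasurableFun.Build _ _ _ _ (id : T -> sg Gamma) (mid Gamma)).
have WGi' : indep_pair P iW iG by move=> A B mA mB; exact: WGi.
pose S : set (sg W * sg Gamma) :=
  [set z | \sum_(j < n) h (Gamma j z.2) * W j z.1 <= x].
have mS : measurable S.
  have mF : measurable_fun setT (fun z : sg W * sg Gamma =>
      \sum_(j < n) h (Gamma j z.2) * W j z.1).
    apply: measurable_sum => j; apply: measurable_funM.
      apply: (measurableT_comp mh).
      by apply: (measurableT_comp (mX Gamma j)).
    by apply: (measurableT_comp (mX W j)).
  have := mF measurableT `]-oo, x]%classic (measurable_itv _).
  by rewrite setTI; congr measurable; apply/seteqP; split => z; rewrite /preimage/= in_itv.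
split; last exact: (indep_pair_prob WGi' mS).
rewrite (_ : (fun _ => _) = (distribution P iW \o ysection S) \o iG).
  by apply: measurableT_comp; [exact: measurable_fun_ysection|exact: measurable_funPT].
apply/funext => w /=; rewrite /distribution/= /pushforward; congr (P _).
by apply/seteqP; split => v; rewrite /ysection/= inE.
Qed.

End conditioning.

(** * The normal distribution function as a function of its variance *)

Section normal_cdf.
Context (R : realType).
Local Notation mu := (@lebesgue_measure R).
Implicit Types (s t x y z : R).

Definition normal_cdf s x : R := fine (normal_prob 0 s `]-oo, x]).

Lemma normal_cdfE s x : normal_prob 0 s `]-oo, x] = (normal_cdf s x)%:E.
Proof. by rewrite fineK// fin_num_measure. Qed.

Lemma normal_cdf_itv01 s x : 0 <= normal_cdf s x <= 1.
Proof.
by rewrite -!lee_fin -normal_cdfE measure_ge0/= probability_le1.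
Qed.

Lemma normal_cdf_dist1 s t x : `|normal_cdf s x - normal_cdf t x| <= 1.
Proof.
have := normal_cdf_itv01 s x; have := normal_cdf_itv01 t x.
by rewrite ler_norml; lra.
Qed.

Lemma normal_cdf_scale b s x : 0 < b -> 0 < s -> normal_cdf s x = normal_cdf (b * s) (b * x).
Proof.
move=> b0 s0; rewrite /normal_cdf -[in RHS]normal_prob_scale//.
by congr (fine (normal_prob 0 s _)); apply/seteqP; split => u /=; rewrite !in_itv/= ler_pM2l.
Qed.

(** The peak 1/sqrt(2 pi) is at most 1/2 because pi >= 2, and |x| <= 1 + x^2/2 <= e^(x^2/2). *)
Lemma normal_pdf1_le x : `|x| * normal_pdf 0 1 x <= 1 / 2.
Proof.
rewrite normal_pdfE// /normal_fun subr0 expr1n mulrCA.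
have peak : @normal_peak R 1 <= 1 / 2.
  have s2 : 2 <= Num.sqrt (1 ^+ 2 * pi *+ 2) :> R.
    rewrite -[leLHS](@gtr0_norm R)// -sqrtr_sqr ler_wsqrtr// expr1n mul1r -mulr_natr.
    by have := pi_ge2 R; lra.
  by rewrite /normal_peak div1r lef_pV2 ?posrE//; lra.
rewrite -[leRHS]mulr1 ler_pM ?normal_peak_ge0 ?mulr_ge0 ?expR_ge0//.
rewrite mulNr expRN -ler_pdivlMr ?invr_gt0 ?expR_gt0// invrK mul1r.
apply: (le_trans _ (expR_ge1Dx _)).
rewrite -real_normK ?num_real// -mulr_natr.
have := sqr_ge0 (`|x| - 1); lra.
Qed.

Lemma normal_cdf_diff_le y z M : y <= z ->
  (forall u, y < u <= z -> normal_pdf 0 1 u <= M) ->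
  0 <= normal_cdf 1 z - normal_cdf 1 y <= M * (z - y).
Proof.
rewrite le_eqVlt => /predU1P[-> _|yz pM]; first by rewrite !subrr mulr0 lexx.
have -> : normal_cdf 1 z - normal_cdf 1 y = fine (normal_prob 0 1 `]y, z]).
  have e : [set` `]-oo, z]] = [set` `]-oo, y]] `|` [set` `]y, z]] :> set R.
    by rewrite -itv_bndbnd_setU// bnd_simp ltW.
  rewrite /normal_cdf e.
  rewrite measureU//=; last first.
    apply/seteqP; split => u //=; rewrite !in_itv/= => -[uy /andP[yu _]].
    by move: uy; rewrite leNgt yu.
  rewrite fineD ?fin_num_measure//; ring.
rewrite fine_ge0//= -lee_fin fineK ?fin_num_measure//.
rewrite /normal_prob; apply: (@le_trans _ _ (\int[mu]_(x in `]y, z]) M%:E)%E).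
  apply: ge0_le_integral => //=.
  - by move=> u _; rewrite lee_fin normal_pdf_ge0.
  - apply/measurable_EFinP; apply: measurable_funTS; exact: measurable_normal_pdf.
by rewrite integral_cst//= lebesgue_measure_itv/= lte_fin yz -EFinD -EFinM lexx.
Qed.

(** As q > 0, the interval between y and q y does not cross 0: its points have modulus at least
    min(q, 1) |y|, so the density there is at most 1 / (2 min(q, 1) |y|). The interval has length |q
    - 1| |y|, and |y| cancels, which makes the bound uniform in y. *)
Lemma normal_cdf1_mul_dist q y : 0 < q ->
  `|normal_cdf 1 (q * y) - normal_cdf 1 y| <= `|q - 1| / (2 * Num.min q 1).
Proof.
move=> q0; have m0 : 0 < Num.min q 1 by rewrite lt_min q0/=.
have [->|y0] := eqVneq y 0; first by rewrite mulr0 subrr normr0 divr_ge0 ?mulr_ge0 ?(ltW m0).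
have ny0 : 0 < `|y| by rewrite normr_gt0.
pose M := (2 * Num.min q 1 * `|y|)^-1.
have pM u : Num.min q 1 * `|y| <= `|u| -> normal_pdf 0 1 u <= M.
  move=> yu; have u0 : 0 < `|u| by rewrite (lt_le_trans _ yu)// mulr_gt0.
  rewrite /M -mulrA invfM -ler_pdivrMr ?invr_gt0 ?mulr_gt0// invrK.
  rewrite -[leRHS]div1r; apply: le_trans (normal_pdf1_le u).
  by rewrite mulrC ler_wpM2r// normal_pdf_ge0.
have H v w : v <= w -> (forall u, v < u <= w -> Num.min q 1 * `|y| <= `|u|) ->
    `|normal_cdf 1 w - normal_cdf 1 v| <= M * `|w - v|.
  move=> vw hu.
  have /andP[h1 h2] := normal_cdf_diff_le vw (fun u vuw => pM u (hu u vuw)).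
  by rewrite !ger0_norm// subr_ge0.
have -> : `|q - 1| / (2 * Num.min q 1) = M * `|q * y - y|.
  rewrite -{2}(mul1r y) -mulrBl normrM /M; field.
  by rewrite !gt_eqF.
have my1 : Num.min q 1 * `|y| <= `|y| by rewrite ler_piMl// ge_min lexx orbT.
have myq : Num.min q 1 * `|y| <= q * `|y| by rewrite ler_wpM2r// ge_min lexx.
have key v w : (v = y /\ w = q * y) \/ (v = q * y /\ w = y) ->
    forall u, v < u <= w -> Num.min q 1 * `|y| <= `|u|.
  move=> vwy u /andP[vu uw]; move: my1 myq.
  have u1 := ler_norm u; have u2 : - u <= `|u| by rewrite -normrN ler_norm.
  have [yp|yn|y0'] := ltgtP 0 y; last by rewrite -y0' eqxx in y0.
  - by case: vwy => -[? ?]; subst v w; rewrite (gtr0_norm yp); lra.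
  - by case: vwy => -[? ?]; subst v w; rewrite (ltr0_norm yn); lra.
have [qy|/ltW qy] := leP (q * y) y.
  by rewrite distrC (distrC (q * y)); apply: H => //; apply: key; right.
by apply: H => //; apply: key; left.
Qed.

Lemma normal_cdf_dist s t x : 0 < s -> 0 < t ->
  `|normal_cdf s x - normal_cdf t x| <= 3 / 2 * `|(s / t) ^+ 2 - 1|.
Proof.
move=> s0 t0.
(* Beyond ratio error 2/3 the trivial bound 1 suffices. *)
have [far|near] := leP (2 / 3) `|(s / t) ^+ 2 - 1|.
  by apply: (le_trans (normal_cdf_dist1 s t x)); lra.
pose q := t / s; have q0 : 0 < q by rewrite divr_gt0.
have -> : normal_cdf s x = normal_cdf 1 (q * (x / t)).
  rewrite (normal_cdf_scale x (b := s^-1)) ?invr_gt0// mulVf ?gt_eqF//.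
  by congr normal_cdf; rewrite /q; field; rewrite !gt_eqF.
have -> : normal_cdf t x = normal_cdf 1 (x / t).
  by rewrite (normal_cdf_scale x (b := t^-1)) ?invr_gt0// mulVf ?gt_eqF// mulrC.
apply: (le_trans (normal_cdf1_mul_dist _ q0)).
set p := s / t in near *.
have p0 : 0 < p by rewrite divr_gt0.
have pq : p * q = 1 by rewrite /p /q; field; rewrite !gt_eqF.
have qE : q = p^-1 by rewrite /p invf_div.
rewrite /Num.min; case: ifPn => q1.
  have p1 : 1 < p by rewrite -invf_lt1// -qE.
  have -> : `|q - 1| / (2 * q) = (p - 1) / 2.
    rewrite ltr0_norm ?subr_lt0// qE; field; rewrite gt_eqF//.
  by rewrite gtr0_norm ?subr_gt0 ?exprn_egt1//; nra.
rewrite -leNgt in q1.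
have p1 : p <= 1 by rewrite -invf_ge1// -qE.
rewrite mulr1 ger0_norm ?subr_ge0// ler0_norm; last by rewrite subr_le0 exprn_ile1// ltW.
(* Closeness keeps p away from 0: p^2 > 1/3 and p <= 1 give p > 1/3, hence 1 <= 3 p (1 + p), which
   is the goal divided by (1 - p) / (2 p). *)
have p2 : 1 / 3 < p ^+ 2.
  by move: near; rewrite ltr_norml => /andP[+ _]; lra.
rewrite qE -(ler_pM2l p0).
have -> : p * ((p^-1 - 1) / 2) = (1 - p) / 2 by field; rewrite gt_eqF.
have : 1 <= 3 * (p * (1 + p)) by nra.
have : 0 <= 1 - p by rewrite subr_ge0.
nra.
Qed.

End normal_cdf.

(** * Poisson increments *)

Section poisson_sums.
Context (R : realType).
Implicit Types (l : R) (k : nat).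

Lemma poisson_pmfS l k : 0 < l ->
  k.+1%:R * poisson_pmf l k.+1 = l * poisson_pmf l k.
Proof.
move=> l0; rewrite /poisson_pmf l0 factS natrM exprS; field.
by rewrite nat1r !pnatr_eq0 -lt0n fact_gt0.
Qed.

Lemma nneseries_poisson_pmf l : 0 < l ->
  (\sum_(0 <= k <oo) (poisson_pmf l k)%:E = 1)%E.
Proof.
move=> l0; rewrite nneseries_esumT; last by move=> k; rewrite lee_fin poisson_pmf_ge0.
by have := probability_setT (poisson_prob l 0%N : probability _ _); rewrite /= /poisson_prob l0.
Qed.

(** The Stein-Chen identity E[X f(X)] = l E[f(X + 1)]; f = 1 and f = id yield the first two
    moments. *)
Lemma nneseries_poisson_pmf_mul l (f : nat -> R) : 0 < l -> (forall k, 0 <= f k) ->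
  (\sum_(0 <= k <oo) (k%:R * f k * poisson_pmf l k)%:E =
   l%:E * \sum_(0 <= k <oo) (f k.+1 * poisson_pmf l k)%:E)%E.
Proof.
move=> l0 f0; rewrite nneseries_recl//; last first.
  by move=> k _; rewrite lee_fin !mulr_ge0// poisson_pmf_ge0.
rewrite !mul0r add0e -(nneseries_addn 1); last first.
  by move=> k; rewrite lee_fin !mulr_ge0// poisson_pmf_ge0.
rewrite -nneseriesZl; last by move=> k _; rewrite lee_fin mulr_ge0// poisson_pmf_ge0.
apply: eq_eseriesr => k _; rewrite addn1 -EFinM; congr EFin.
by rewrite mulrAC poisson_pmfS// mulrCA mulrC mulrA.
Qed.

Lemma nneseries_poisson_mean l : 0 < l ->
  (\sum_(0 <= k <oo) (k%:R * poisson_pmf l k)%:E = l%:E)%E.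
Proof.
move=> l0; under eq_eseriesr do rewrite -[X in X * _]mulr1.
rewrite (@nneseries_poisson_pmf_mul l (fun=> 1))//.
by under eq_eseriesr do rewrite mul1r; rewrite nneseries_poisson_pmf// mule1.
Qed.

Lemma nneseries_poisson_sqr l : 0 < l ->
  (\sum_(0 <= k <oo) (k%:R ^+ 2 * poisson_pmf l k)%:E = (l ^+ 2 + l)%:E)%E.
Proof.
move=> l0; under eq_eseriesr do rewrite expr2.
rewrite (@nneseries_poisson_pmf_mul l (fun k => k%:R))//.
under eq_eseriesr do rewrite -natr1 mulrDl mul1r EFinD.
rewrite nneseriesD//.
- rewrite nneseries_poisson_mean// nneseries_poisson_pmf// -EFinD -EFinM.
  by rewrite mulrDr mulr1.
- by move=> k _ _; rewrite lee_fin mulr_ge0// poisson_pmf_ge0.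
- by move=> k _ _; rewrite lee_fin poisson_pmf_ge0.
Qed.

End poisson_sums.

Section poisson_increments.
Context d (T : measurableType d) (R : realType) (P : probability T R).

Lemma ge0_integral_natRV (X : {mfun T >-> nat}) (f : nat -> R) :
    (forall k, 0 <= f k) ->
  (\int[P]_w (f (X w))%:E = \sum_(0 <= k <oo) (f k)%:E * P [set w | X w = k])%E.
Proof.
move=> f0.
have mX k : measurable [set w | X w = k].
  by rewrite -[X in measurable X]setTI; exact: (measurable_funPT X measurableT [set k]).
have UX : [set: T] = \bigcup_k [set w | X w = k].
  by apply/seteqP; split => // w _; exists (X w).
rewrite UX ge0_integral_bigcup//.
- apply: eq_eseriesr => k _.
  rewrite (eq_integral (cst (f k)%:E)); first by rewrite integral_cst.
  by move=> w; rewrite inE /= => ->.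
- rewrite -UX; apply/measurable_EFinP.
  by apply: (measurableT_comp (f := f)).
- by move=> w _; rewrite lee_fin.
- apply/trivIsetP => i j _ _ ij; apply/seteqP; split => // w /= [iw jw].
  by move: ij; rewrite -iw -jw eqxx.
Qed.

Variable N : R -> {RV P >-> nat}.

(** The subtraction is truncated; since N is almost surely nondecreasing, for 0 <= s <= t this is
    almost surely the number of points in ]s, t]. *)
Definition incr (s t : R) (w : T) : nat := (N t w - N s w)%N.

Lemma measurable_incr s t : measurable_fun setT (incr s t).
Proof. exact: measurable_fun_subn. Qed.

HB.instance Definition _ s t :=
  isMeasurableFun.Build _ _ _ _ (incr s t) (measurable_incr s t).

Hypothesis NP : poisson_process 1 N.

Let incr_pmf s t k : 0 <= s -> s < t ->
  P [set w | incr s t w = k] = (poisson_pmf (t - s) k)%:E.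
Proof. by move=> s0 st; case: NP => _ /(_ _ _ s0 st k) + _; rewrite mul1r. Qed.

Lemma incr_mean s t : 0 <= s -> s < t ->
  (\int[P]_w ((incr s t w)%:R)%:E = (t - s)%:E)%E.
Proof.
move=> s0 st; rewrite (@ge0_integral_natRV (incr s t) (fun k => k%:R))//.
under eq_eseriesr do rewrite incr_pmf// -EFinM.
by rewrite nneseries_poisson_mean// subr_gt0.
Qed.

Lemma incr_sqr s t : 0 <= s -> s < t ->
  (\int[P]_w ((incr s t w)%:R ^+ 2)%:E = ((t - s) ^+ 2 + (t - s))%:E)%E.
Proof.
move=> s0 st; rewrite (@ge0_integral_natRV (incr s t) (fun k => k%:R ^+ 2))//.
under eq_eseriesr do rewrite incr_pmf// -EFinM.
by rewrite nneseries_poisson_sqr// subr_gt0.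
Qed.

Variables (t : nat -> R) (u : nat -> R) (n : nat).
Hypotheses (t0 : 0 <= t 0%N) (ti : forall i, t i < t i.+1) (u0 : forall i, 0 <= u i).

Let X i := incr (t i) (t i.+1).

Let t_ge0 i : 0 <= t i.
Proof. by elim: i => // i ih; rewrite (le_trans ih)// ltW. Qed.

Let tnd : nondecreasing_seq t.
Proof. by apply/nondecreasing_seqP => i; exact: ltW. Qed.

Lemma incr_prod i j : i != j ->
  (\int[P]_w ((X i w)%:R * (X j w)%:R)%:E =
   ((t i.+1 - t i) * (t j.+1 - t j))%:E)%E.
Proof.
move=> ij.
have Xi : indep_pair P (X i) (X j).
  move=> A B mA mB; case: NP => _ _ /(_ t t0 tnd) ind.
  pose D k := if k == i then A else B.
  have := ind [fset i; j]%fset D (fun k => ltac:(by rewrite /D; case: ifP)).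
  rewrite big_fsetU1 ?inE//= big_seq_fset1 /D eqxx eq_sym (negbTE ij) => <-.
  congr (P _); apply/seteqP; split => w /=.
    by move=> [wA wB] k /=; rewrite !inE => /orP[|]/eqP ->; rewrite ?eqxx// eq_sym (negbTE ij).
  by move=> h; split; [have := h i|have := h j];
    rewrite /= !inE eqxx ?orbT ?(eq_sym j) ?(negbTE ij); apply.
rewrite (indep_pair_integral (f := fun z : nat * nat => (z.1%:R * z.2%:R)%:E) Xi)//; last first.
  apply/measurable_EFinP; apply: measurable_funM.
    by apply: (measurableT_comp (f := fun k : nat => k%:R : R)).
  by apply: (measurableT_comp (f := fun k : nat => k%:R : R)).
under eq_integral.
  move=> w _ /=.
  under eq_integral do rewrite mulrC EFinM.
  rewrite ge0_integralZl//=; last first.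
    by apply/measurable_EFinP; apply: (measurableT_comp (f := fun k : nat => k%:R : R)).
  rewrite incr_mean//.
  over.
rewrite ge0_integralZr//=; last 2 first.
- by apply/measurable_EFinP; apply: (measurableT_comp (f := fun k : nat => k%:R : R)).
- by rewrite lee_fin subr_ge0 ltW.
by rewrite incr_mean// -EFinM mulrC.
Qed.

Definition wsum (w : T) : R := \sum_(i < n) u i * (X i w)%:R.

Lemma measurable_wsum : measurable_fun setT wsum.
Proof.
apply: measurable_sum => i; apply: measurable_funM => //.
by apply: (measurableT_comp (f := fun k : nat => k%:R : R)).
Qed.

Lemma wsum_ge0 w : 0 <= wsum w.
Proof. by apply: sumr_ge0 => i _; rewrite mulr_ge0. Qed.

Lemma wsum_mean :
  (\int[P]_w (wsum w)%:E = (\sum_(i < n) u i * (t i.+1 - t i))%:E)%E.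
Proof.
under eq_integral do rewrite /wsum -sumEFin.
rewrite ge0_integral_sum//; last 2 first.
- move=> i; apply/measurable_EFinP; apply: measurable_funM => //.
  by apply: (measurableT_comp (f := fun k : nat => k%:R : R)).
- by move=> i w _; rewrite lee_fin mulr_ge0.
rewrite -sumEFin; apply: eq_bigr => i _.
under eq_integral do rewrite EFinM.
rewrite ge0_integralZl//; last 2 first.
- by apply/measurable_EFinP; apply: (measurableT_comp (f := fun k : nat => k%:R : R)).
- by rewrite lee_fin.
by rewrite incr_mean.
Qed.

(** Off the diagonal, independence makes the products of increments match the squared mean. On it,
    the second moment exceeds the squared mean by the cell length, the variance of a Poisson
    variable being its mean. *)
Lemma wsum_sqr :
  (\int[P]_w (wsum w ^+ 2)%:E = ((\sum_(i < n) u i * (t i.+1 - t i)) ^+ 2 +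
    \sum_(i < n) u i ^+ 2 * (t i.+1 - t i))%:E)%E.
Proof.
have mX i : measurable_fun setT (fun w => (X i w)%:R : R).
  by apply: (measurableT_comp (f := fun k : nat => k%:R : R)).
under eq_integral do rewrite /wsum expr2 big_distrlr/= -sumEFin.
rewrite ge0_integral_sum//; last 2 first.
- move=> i; apply/measurable_EFinP; apply: measurable_sum => j.
  by apply: measurable_funM; apply: measurable_funM.
- by move=> i w _; rewrite lee_fin sumr_ge0// => j _; rewrite !mulr_ge0.
rewrite expr2 big_distrlr/= -big_split/= -sumEFin; apply: eq_bigr => i _.
under eq_integral do rewrite -sumEFin.
rewrite ge0_integral_sum//; last 2 first.
- move=> j; apply/measurable_EFinP.
  by apply: measurable_funM; apply: measurable_funM.
- by move=> j w _; rewrite lee_fin !mulr_ge0.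
have -> : u i ^+ 2 * (t i.+1 - t i) =
    \sum_(j < n) if j == i then u i ^+ 2 * (t i.+1 - t i) else 0.
  by rewrite -big_mkcond/= big_pred1_eq.
rewrite -big_split/= -sumEFin; apply: eq_bigr => j _.
under eq_integral do rewrite mulrACA EFinM.
rewrite ge0_integralZl//; last 2 first.
- by apply/measurable_EFinP; exact: measurable_funM.
- by rewrite lee_fin mulr_ge0.
case: eqP => [->|/eqP ji].
  by under eq_integral do rewrite -expr2; rewrite incr_sqr// -EFinM; congr EFin; ring.
rewrite incr_prod; last by apply: contra ji => /eqP/val_inj ->.
by rewrite -EFinM; congr EFin; ring.
Qed.

End poisson_increments.

(** * Bracketing by step functions *)

Section grid_bracket.
Context (R : realType).
Variables (f : R -> R) (t : nat -> R) (k n : nat) (G : nat -> R) (N : R -> nat).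
Hypotheses (t0 : 0 <= t 0%N) (ti : forall i, t i < t i.+1).
Hypothesis f0 : forall x, 0 <= f x.
Hypothesis fni : forall x y, t 0%N <= x -> x <= y -> f y <= f x.
Hypothesis Nnd : forall x y, 0 <= x -> x <= y -> (N x <= N y)%N.
Hypothesis GN : forall j x, 0 <= x -> (G j <= x) = (j < N x)%N.
Hypothesis Nn : (N (t k) <= n)%N.

Definition upper_weight i := f (t i).

(* The last cell gets weight 0: the window is open at [t k], whereas an arrival
   at exactly [t k] is counted by [N (t k)]. *)
Definition lower_weight i := if (i.+1 < k)%N then f (t i.+1) else 0.

Let h x := if t 0%N < x < t k then f x else 0.

Let t_nd i j : (i <= j)%N -> t i <= t j.
Proof. by move: i j; apply/nondecreasing_seqP => i; exact: ltW. Qed.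

Let t_ge0 i : 0 <= t i. Proof. exact: le_trans (t_nd (leq0n i)). Qed.

(** By the duality [GN], the indices in this range are exactly the arrivals in ]t i, t i.+1], where
    the nonincreasing f lies between its values at the end points. *)
Let cell i j : (i < k)%N -> (N (t i) <= j < N (t i.+1))%N ->
  lower_weight i <= h (G j) <= upper_weight i.
Proof.
move=> ik /andP[]; rewrite leqNgt -!GN// -ltNge => tG Gt.
have t0G : t 0%N < G j by rewrite (le_lt_trans _ tG)// t_nd.
rewrite /lower_weight /upper_weight /h t0G/=; apply/andP; split.
- case: ifPn => // ik1; last by case: ifP.
  have -> : G j < t k.
    by rewrite (le_lt_trans Gt)// (lt_le_trans (ti _))// t_nd.
  by apply: fni => //; exact: ltW.
- by case: ifP => // _; apply: fni; [exact: t_nd|exact: ltW].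
Qed.

Let grid i : (i <= k)%N ->
  \sum_(i' < i) lower_weight i' * (N (t i'.+1) - N (t i'))%:R <=
    \sum_(N (t 0%N) <= j < N (t i)) h (G j) <=
  \sum_(i' < i) upper_weight i' * (N (t i'.+1) - N (t i'))%:R.
Proof.
elim: i => [|i ih] ik; first by rewrite big_geq// !big_ord0 lexx.
have /andP[ih1 ih2] := ih (ltnW ik).
have NN : (N (t i) <= N (t i.+1))%N by rewrite Nnd// ltW.
rewrite !big_ord_recr/= (@big_cat_nat _ _ _ (N (t i)))//=; last exact/Nnd/t_nd.
have cst a : a * (N (t i.+1) - N (t i))%:R = \sum_(N (t i) <= j < N (t i.+1)) a.
  by rewrite sumr_const_nat mulr_natr.
apply/andP; split; apply: lerD => //; rewrite cst; apply: ler_sum_nat => j /(cell ik)/andP[] //.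
Qed.

Lemma grid_bracket :
  \sum_(i < k) lower_weight i * (N (t i.+1) - N (t i))%:R <=
    \sum_(j < n) h (G j) <=
  \sum_(i < k) upper_weight i * (N (t i.+1) - N (t i))%:R.
Proof.
(* Indices below N (t 0) are arrivals up to t 0 and those from N (t k) on are arrivals after t k; h
   vanishes at both, so cutting at any n >= N (t k) loses nothing. *)
suff -> : \sum_(j < n) h (G j) = \sum_(N (t 0%N) <= j < N (t k)) h (G j) by exact: grid.
rewrite -(big_mkord xpredT (fun j => h (G j))).
have N0k : (N (t 0%N) <= N (t k))%N by exact/Nnd/t_nd.
rewrite (@big_cat_nat _ _ _ (N (t 0%N)))//=; last exact: leq_trans Nn.
rewrite [X in _ + X](@big_cat_nat _ _ _ (N (t k)))//=.
rewrite [X in X + _]big_nat_cond [X in X + _]big1 ?add0r; last first.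
  by move=> j; rewrite andbT -GN//= => Gt; rewrite /h ltNge Gt.
rewrite [X in _ + X = _]big_nat_cond [X in _ + X = _]big1 ?addr0//.
move=> j; rewrite andbT => /andP[+ _]; rewrite leqNgt -GN// => Gt.
by rewrite /h; move: Gt; rewrite -ltNge => /ltW; rewrite leNgt => /negbTE ->; rewrite andbF.
Qed.

Lemma lower_upper_weight i : lower_weight i <= upper_weight i.
Proof.
rewrite /lower_weight /upper_weight; case: ifP => // _.
by apply: fni; [exact: t_nd|exact: ltW].
Qed.

Lemma lower_weight_ge0 i : 0 <= lower_weight i.
Proof. by rewrite /lower_weight; case: ifP. Qed.

End grid_bracket.

Section EFin_integral.
Context d (T : measurableType d) (R : realType) (P : {measure set T -> \bar R}).

Lemma ge0_integralD_EFin (f g : T -> R) :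
    measurable_fun setT f -> measurable_fun setT g ->
    (forall w, 0 <= f w) -> (forall w, 0 <= g w) ->
  (\int[P]_w (f w + g w)%:E = \int[P]_w (f w)%:E + \int[P]_w (g w)%:E)%E.
Proof.
move=> mf mg f0 g0; under eq_integral do rewrite EFinD.
by rewrite ge0_integralD//; try (by move=> w _; rewrite lee_fin); exact/measurable_EFinP.
Qed.

Lemma ge0_integralZ_EFin (r : R) (f : T -> R) :
    measurable_fun setT f -> (forall w, 0 <= f w) -> 0 <= r ->
  (\int[P]_w (r * f w)%:E = r%:E * \int[P]_w (f w)%:E)%E.
Proof.
move=> mf f0 r0; under eq_integral do rewrite EFinM.
by rewrite ge0_integralZl//; [exact/measurable_EFinP|move=> w _; rewrite lee_fin].
Qed.

End EFin_integral.

(** * Mean deviation of a bracketed sum *)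

Section moment_error.
Context d (T : measurableType d) (R : realType) (P : probability T R).
Variables (N : R -> {RV P >-> nat}) (t u l : nat -> R) (k : nat) (m q : R).
Hypothesis NP : poisson_process 1 N.
Hypotheses (t0 : 0 <= t 0%N) (ti : forall i, t i < t i.+1).
Hypotheses (l0 : forall i, 0 <= l i) (lu : forall i, l i <= u i).
Hypotheses (m0 : 0 < m) (q0 : 0 < q).

Let U := wsum N t u k.
Let L := wsum N t l k.

Let u0 i : 0 <= u i. Proof. exact: le_trans (lu i). Qed.

(** A majorant of |V - m| for every V between L and U. Replacing |U - m| by a quadratic expression
    makes the mean explicit and stands in for the Cauchy-Schwarz inequality; the parameter q is free
    until it is set to a standard deviation. *)
Definition deviation w : R := (U w - m) ^+ 2 / (2 * q) + q / 2 + (U w - L w).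

Lemma wsum_le w : L w <= U w.
Proof. by apply: ler_sum => i _; rewrite ler_wpM2r. Qed.

Lemma deviation_ge0 w : 0 <= deviation w.
Proof.
rewrite /deviation addr_ge0 ?subr_ge0 ?wsum_le// addr_ge0//; last by rewrite divr_ge0// ltW.
by rewrite divr_ge0 ?sqr_ge0// mulr_ge0// ltW.
Qed.

Lemma measurable_deviation : measurable_fun setT deviation.
Proof.
have mU : measurable_fun setT U by exact: measurable_wsum.
have mL : measurable_fun setT L by exact: measurable_wsum.
apply: measurable_funD; last exact: measurable_funB.
apply: measurable_funD => //; apply: measurable_funM => //.
by apply: measurable_funX; exact: measurable_funB.
Qed.

Lemma deviation_dist w v : L w <= v <= U w -> `|v - m| <= deviation w.
Proof.
move=> /andP[Lv vU]; set a := U w - m.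
have ha : `|a| <= a ^+ 2 / (2 * q) + q / 2.
  (* AM-GM *)
  have -> : a ^+ 2 / (2 * q) + q / 2 = `|a| + (`|a| - q) ^+ 2 / (2 * q).
    by rewrite -(real_normK (num_real a)); field; rewrite gt_eqF.
  by rewrite lerDl divr_ge0 ?sqr_ge0// mulr_ge0// ltW.
rewrite /deviation -/a; move: ha; have := ler_norm a; have := ler_norm (- a); rewrite normrN.
by set b := _ + q / 2; rewrite /a => h1 h2 h3; rewrite ler_norml; apply/andP; split; lra.
Qed.

Lemma deviation_mean :
  let SU := \sum_(i < k) u i * (t i.+1 - t i) in
  (\int[P]_w (deviation w)%:E =
   (((SU - m) ^+ 2 + \sum_(i < k) u i ^+ 2 * (t i.+1 - t i)) / (2 * q) + q / 2 +
    (SU - \sum_(i < k) l i * (t i.+1 - t i)))%:E)%E.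
Proof.
move=> SU; set SL := \sum_(i < k) l i * _; set SV := \sum_(i < k) u i ^+ 2 * _.
have mU : measurable_fun setT U by exact: measurable_wsum.
have mL : measurable_fun setT L by exact: measurable_wsum.
have U0 w : 0 <= U w by exact: wsum_ge0.
have L0 w : 0 <= L w by exact: wsum_ge0.
have iU : (\int[P]_w (U w)%:E = SU%:E)%E by exact: wsum_mean.
have iL : (\int[P]_w (L w)%:E = SL%:E)%E by exact: wsum_mean.
have iU2 : (\int[P]_w (U w ^+ 2)%:E = (SU ^+ 2 + SV)%:E)%E by exact: wsum_sqr.
have iD := @ge0_integralD_EFin _ _ _ P.
have iZ := @ge0_integralZ_EFin _ _ _ P.
have iq0 : 0 <= q^-1 by rewrite invr_ge0 ltW.
have mq0 : 0 <= m / q by rewrite mulr_ge0// ltW.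
(* The negative terms of [deviation] are moved to the other side, so that only
   integrals of nonnegative functions occur. *)
pose A w := deviation w + (m / q * U w + L w).
pose C := m ^+ 2 / (2 * q) + q / 2.
have C0 : 0 <= C.
  by rewrite /C addr_ge0// divr_ge0 ?sqr_ge0 ?(ltW q0)// mulr_ge0// ltW.
have iA1 : (\int[P]_w (A w)%:E = \int[P]_w (deviation w)%:E + (m / q * SU + SL)%:E)%E.
  rewrite (iD deviation (fun w => m / q * U w + L w)); last 4 first.
  - exact: measurable_deviation.
  - by apply: measurable_funD => //; exact: measurable_funM.
  - exact: deviation_ge0.
  - by move=> w; rewrite addr_ge0// mulr_ge0.
  rewrite (iD (fun w => m / q * U w) L)//; last 2 first.
  - exact: measurable_funM.
  - by move=> w; rewrite mulr_ge0.
  by rewrite iZ// iU iL.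
have iA2 : (\int[P]_w (A w)%:E = ((2 * q)^-1 * (SU ^+ 2 + SV) + (SU + C))%:E)%E.
  rewrite (eq_integral (fun w => ((2 * q)^-1 * U w ^+ 2 + (U w + C))%:E)); last first.
    by move=> w _; congr EFin; rewrite /A /deviation /C; field; rewrite gt_eqF.
  rewrite (iD (fun w => (2 * q)^-1 * U w ^+ 2) (fun w => U w + C)); last 4 first.
  - by apply: measurable_funM => //; exact: measurable_funX.
  - exact: measurable_funD.
  - by move=> w; rewrite mulr_ge0 ?sqr_ge0// invr_ge0 mulr_ge0// ltW.
  - by move=> w; rewrite addr_ge0.
  rewrite (iD U (fun=> C))// (iZ _ (fun w => U w ^+ 2)); last 3 first.
  - exact: measurable_funX.
  - by move=> w; exact: sqr_ge0.
  - by rewrite invr_ge0 mulr_ge0// ltW.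
  by rewrite iU iU2 integral_cst//= probability_setT mule1.
have := iA1; rewrite iA2.
(* An infinite integral would contradict the finite total, so it is a real r, for which the equation
   is solved. *)
case: (\int[P]_w (deviation w)%:E)%E => // r /eqP; rewrite -EFinD eqe => /eqP h.
congr EFin; have -> : r = r + (m / q * SU + SL) - (m / q * SU + SL) by ring.
by rewrite -h /C; field; rewrite gt_eqF.
Qed.

End moment_error.

(** * Normal approximation on a finite window *)

Section window_bound.
Context d (T : measurableType d) (R : realType) (P : probability T R).
Variables (alpha sigma m q : R) (W Gamma : nat -> {RV P >-> R}).
Variables (N : R -> {RV P >-> nat}) (t : nat -> R) (k : nat).
Hypotheses (alpha0 : 0 < alpha) (sigma0 : 0 < sigma) (m0 : 0 < m) (q0 : 0 < q).
Hypotheses (t0 : 0 < t 0%N) (ti : forall i, t i < t i.+1).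
Hypothesis NP : poisson_process 1 N.
Hypothesis GN : {ae P, forall w, forall (j : nat) (t : R), 0 <= t ->
  (Gamma j w <= t) = (j < N t w)%N}.
Hypothesis Ws : forall j, normally_distributed (W j) 0 sigma.
Hypothesis Wi : mutually_independent P (fun j => W j : T -> R).
Hypothesis WGi : independent_families P
  (fun j => W j : T -> R) (fun j => Gamma j : T -> R).

Let f (x : R) := (x `^ (- alpha^-1)) ^+ 2.

Let f0 x : 0 <= f x. Proof. exact: sqr_ge0. Qed.

Let fni x y : t 0%N <= x -> x <= y -> f y <= f x.
Proof.
move=> tx xy; have x0 : 0 < x by exact: lt_le_trans tx.
have y0 : 0 < y by exact: lt_le_trans xy.
rewrite /f ler_pXn2r// ?nnegrE ?powR_ge0// !powRN lef_pV2 ?posrE ?powR_gt0//.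
by rewrite ge0_ler_powR ?nnegrE ?invr_ge0 ?(ltW alpha0) ?(ltW x0) ?(ltW y0).
Qed.

Let b (x : R) := if t 0%N < x < t k then x `^ (- alpha^-1) else 0.

Let mb : measurable_fun setT b.
Proof.
apply: measurable_fun_ifT => //.
by apply: measurable_and => /=; exact: measurable_fun_ltr.
Qed.

Let u := upper_weight f t.
Let l := lower_weight f t k.
Let dev := deviation N t u l k m q.

Let good : exists Z : set T, [/\ measurable Z, P Z = 0%E &
  forall w, ~ Z w ->
    (forall x y, 0 <= x -> x <= y -> (N x w <= N y w)%N) /\
    (forall j x, 0 <= x -> (Gamma j w <= x) = (j < N x w)%N)].
Proof.
have [N0 _ _] := NP; have [Z [mZ PZ sZ]] := negligibleU N0 GN.
exists Z; split => // w nZ; split.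
  have [] : (N 0 w = 0%N /\ forall x y, 0 <= x -> x <= y -> (N x w <= N y w)%N).
    by apply: contrapT => h; apply: nZ; apply: sZ; left.
  by [].
by apply: contrapT => h; apply: nZ; apply: sZ; right.
Qed.

(** [N (t k)] is finite everywhere, so these events decrease to the empty set. A random number of
    summands can thus be replaced by a deterministic one. *)
Let escape (e : R) : 0 < e -> exists n, (P [set w | (n < N (t k) w)%N] <= e%:E)%E.
Proof.
move=> e0; pose A n := [set w | (n < N (t k) w)%N].
have mA n : measurable (A n).
  rewrite -[X in measurable X]setTI.
  exact: (measurable_funPT (N (t k)) measurableT [set j | (n < j)%N]).
have cap0 : \bigcap_n A n = set0.
  by apply/seteqP; split => // w /(_ (N (t k) w) I); rewrite /A/= ltnn.
have : P (A n) @[n --> \oo] --> P (\bigcap_n A n).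
  apply: nonincreasing_cvg_mu => //.
  - by rewrite (le_lt_trans (probability_le1 _ _))// ltry.
  - exact: bigcap_measurableType.
  - by move=> i j ij; apply/subsetPset => w; apply: leq_ltn_trans.
rewrite cap0 measure0 => /fine_cvgP[_ /cvgrPdist_le /(_ _ e0)[n _ /(_ n)]].
rewrite /= leqnn sub0r normrN => /(_ isT) h; exists n.
have -> : P [set w | (n < N (t k) w)%N] = (fine (P (A n)))%:E.
  by rewrite fineK// fin_num_measure.
by rewrite lee_fin (le_trans (ler_norm _)).
Qed.

Let window_sumE n w : (forall j x, 0 <= x -> (Gamma j w <= x) = (j < N x w)%N) ->
    (N (t k) w <= n)%N ->
  window_sum alpha W Gamma (t 0%N) (t k) w = \sum_(j < n) b (Gamma j w) * W j w.
Proof.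
move=> G Nn; rewrite /window_sum.
rewrite (@fsbig_ord _ _ _ n (fun j => b (Gamma j w) * W j w)).
rewrite -(@fsbig_widen _ _ _ _ [set j | t 0%N < Gamma j w < t k]).
- by apply: eq_fsbigr => j; rewrite inE /= => jA; rewrite /b jA mulrC.
- move=> j /= /andP[_ Gt]; apply: leq_trans Nn; rewrite -G ?ltW//.
  elim: k => [|i]; [exact: t0|by move=> /lt_trans; apply].
- by move=> j [_ /= /negP jA]; rewrite /preimage/= /b (negbTE jA) mul0r.
Qed.

Let cdf_window x := fine (cdf (window_sum alpha W Gamma (t 0%N) (t k) : {RV P >-> R}) x).

Let Q n x w := P [set v | lincomb W (fun j => b (Gamma j w)) n v <= x].

Let measurable_lincomb_le c n x : measurable [set v | lincomb W c n v <= x].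
Proof.
have := measurable_lincomb W c n measurableT (measurable_itv `]-oo, x]).
by rewrite setTI; congr measurable; apply/seteqP; split => z; rewrite /preimage/= in_itv.
Qed.

Let Q_fin n x w : Q n x w = (fine (Q n x w))%:E.
Proof. by rewrite fineK// fin_num_measure. Qed.

Let Q01 n x w : 0 <= fine (Q n x w) <= 1.
Proof. by rewrite -!lee_fin -Q_fin measure_ge0 probability_le1. Qed.

Let s := sigma * Num.sqrt m.

Let s_gt0 : 0 < s. Proof. by rewrite mulr_gt0// sqrtr_gt0. Qed.

Let l0 i : 0 <= l i. Proof. exact: lower_weight_ge0. Qed.

Let lu i : l i <= u i. Proof. exact: lower_upper_weight. Qed.

Let t0' : 0 <= t 0%N. Proof. exact: ltW. Qed.

Let cond_dist n x w :
    (forall x y, 0 <= x -> x <= y -> (N x w <= N y w)%N) ->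
    (forall j x, 0 <= x -> (Gamma j w <= x) = (j < N x w)%N) ->
    (N (t k) w <= n)%N ->
  `|fine (Q n x w) - normal_cdf s x| <= 3 / (2 * m) * dev w.
Proof.
move=> Nnd G Nn; set v := \sum_(j < n) b (Gamma j w) ^+ 2.
have vLU : wsum N t l k w <= v <= wsum N t u k w.
  have -> : v = \sum_(j < n) if t 0%N < Gamma j w < t k then f (Gamma j w) else 0.
    by apply: eq_bigr => j _; rewrite /b; case: ifP => //; rewrite expr0n.
  exact: (@grid_bracket R f t k n (fun j => Gamma j w) (fun x => N x w) t0' ti f0 fni Nnd G Nn).
have vm := deviation_dist m q0 vLU.
have c0 : 0 <= 3 / (2 * m) by rewrite divr_ge0// mulr_ge0// ltW.
apply: le_trans (ler_wpM2l c0 vm).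
have v0 : 0 <= v by apply: sumr_ge0 => j _; exact: sqr_ge0.
(* If v = 0 the conditional law is a point mass, outside the reach of [lincomb_normal]; but the
   right side is then 3/2, above the trivial bound 1. *)
have [v00|vn0] := eqVneq v 0.
  rewrite v00 sub0r normrN (gtr0_norm m0).
  have -> : 3 / (2 * m) * m = 3 / 2 by field; rewrite gt_eqF.
  have := Q01 n x w; have := normal_cdf_itv01 s x.
  by rewrite ler_norml => /andP[? ?] /andP[? ?]; apply/andP; split; lra.
have vp : 0 < v by rewrite lt_neqAle eq_sym vn0.
have Ws' j A : measurable A -> P (W j @^-1` A) = normal_prob 0 sigma A by exact: Ws.
have b0 j : 0 <= b (Gamma j w) by rewrite /b; case: ifP => // _; exact: powR_ge0.
have QE : Q n x w = normal_prob 0 (sigma * Num.sqrt v) `]-oo, x].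
  transitivity (P (lincomb W (fun j => b (Gamma j w)) n @^-1` `]-oo, x])).
    by rewrite /Q; congr (P _); apply/seteqP; split => z; rewrite /preimage/= in_itv.
  exact: (lincomb_normal sigma0 Ws' Wi b0 vp).
rewrite QE -/(normal_cdf _ x).
apply: le_trans (normal_cdf_dist _ _ s_gt0) _; first by rewrite mulr_gt0// sqrtr_gt0.
have -> : sigma * Num.sqrt v / s = Num.sqrt v / Num.sqrt m.
  by rewrite /s; field; rewrite !gt_eqF// sqrtr_gt0.
rewrite exprMn exprVn !sqr_sqrtr ?(ltW m0)//.
have -> : v / m - 1 = (v - m) / m by field; rewrite gt_eqF.
rewrite normrM normfV (gtr0_norm m0).
by rewrite le_eqVlt; apply/orP; left; apply/eqP; field; rewrite gt_eqF.
Qed.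

(** The estimate [cond_dist] is integrated. The bad event B (more than n arrivals, or the
    exceptional null set) has probability at most eps/2 and is paid for twice: once where
    [cond_dist] fails, once for replacing the window sum by its truncation. *)
Lemma window_bound x (e : R) : (\int[P]_w (dev w)%:E = e%:E)%E ->
  `|cdf_window x - normal_cdf s x| <= 3 / (2 * m) * e.
Proof.
move=> dev_e; apply/ler_addgt0Pr => eps eps0.
have eps20 : 0 < eps / 2 by rewrite divr_gt0.
have [n Pn] := escape eps20.
have [Z [mZ PZ hZ]] := good.
have c0 : 0 <= 3 / (2 * m) by rewrite divr_ge0// mulr_ge0// ltW.
pose B := [set w | (n < N (t k) w)%N] `|` Z.
have mA : measurable [set w | (n < N (t k) w)%N].
  rewrite -[X in measurable X]setTI.
  exact: (measurable_funPT (N (t k)) measurableT [set j | (n < j)%N]).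
have mB : measurable B by exact: measurableU.
have PB : fine (P B) <= eps / 2.
  rewrite -lee_fin fineK ?fin_num_measure//.
  apply: (le_trans (measureU2 P mA mZ)).
  by rewrite [X in (_ + X)%E](_ : _ = 0%E) ?adde0.
have notB w : ~ B w -> [/\ (forall x y, 0 <= x -> x <= y -> (N x w <= N y w)%N),
    (forall j x, 0 <= x -> (Gamma j w <= x) = (j < N x w)%N) & (N (t k) w <= n)%N].
  move=> nB; have [|h1 h2] := hZ w; first by move=> Zw; apply: nB; right.
  by split => //; rewrite leqNgt; apply/negP => ?; apply: nB; left.
have [mQ PQ] := @indep_families_lincomb_prob _ _ _ P W Gamma b n x mb WGi.
have mq : measurable_fun setT (fun w => fine (Q n x w)).
  by apply/measurable_EFinP; apply: eq_measurable_fun mQ => w _; exact: Q_fin.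
have mdev : measurable_fun setT dev by exact: measurable_deviation.
have dev0 w : 0 <= dev w by exact: deviation_ge0.
pose ind w : R := \1_B w.
have mind : measurable_fun setT ind by exact: measurable_indic.
have ind0 w : 0 <= ind w by rewrite /ind.
have iind : (\int[P]_w (ind w)%:E = (fine (P B))%:E)%E.
  by rewrite integral_indic// setIT fineK// fin_num_measure.
have pw w : `|fine (Q n x w) - normal_cdf s x| <= 3 / (2 * m) * dev w + ind w.
  rewrite /ind indicE; have [wB|/negP] := boolP (w \in B).
    apply: (@le_trans _ _ 1); last by rewrite lerDr mulr_ge0.
    have := Q01 n x w; have := normal_cdf_itv01 s x.
    by rewrite ler_norml => /andP[? ?] /andP[? ?]; apply/andP; split; lra.
  by rewrite inE => /notB[? ? ?]; rewrite addr0 cond_dist.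
set pn := fine (P [set w | \sum_(j < n) b (Gamma j w) * W j w <= x]).
have mR : measurable [set w | \sum_(j < n) b (Gamma j w) * W j w <= x].
  have mF : measurable_fun setT (fun w => \sum_(j < n) b (Gamma j w) * W j w).
    by apply: measurable_sum => j; apply: measurable_funM => //; exact: measurableT_comp.
  have := mF measurableT `]-oo, x]%classic (measurable_itv _).
  by rewrite setTI; congr measurable; apply/seteqP; split => z; rewrite /preimage/= in_itv.
have iQ : (\int[P]_w (fine (Q n x w))%:E = pn%:E)%E.
  rewrite /pn fineK ?fin_num_measure// PQ.
  by apply: eq_integral => w _; rewrite -Q_fin.
have mcd : measurable_fun setT (fun w => 3 / (2 * m) * dev w) by exact: measurable_funM.
have icd : (\int[P]_w (3 / (2 * m) * dev w)%:E = (3 / (2 * m) * e)%:E)%E.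
  by rewrite ge0_integralZ_EFin// dev_e.
have Phi01 := normal_cdf_itv01 s x.
have icst : (\int[P]_w (normal_cdf s x)%:E = (normal_cdf s x)%:E)%E.
  by rewrite integral_cst//= probability_setT mule1.
have ci_ge0 w : 0 <= 3 / (2 * m) * dev w + ind w by rewrite addr_ge0// mulr_ge0.
have mci : measurable_fun setT (fun w => 3 / (2 * m) * dev w + ind w).
  exact: measurable_funD.
(* The bound on the absolute value is integrated as two one-sided inequalities, arranged so that
   each side is nonnegative. *)
have isum (h : T -> R) (r : R) : measurable_fun setT h -> (forall w, 0 <= h w) ->
    (\int[P]_w (h w)%:E = r%:E)%E ->
    (\int[P]_w (h w + (3 / (2 * m) * dev w + ind w))%:E =
     (r + (3 / (2 * m) * e + fine (P B)))%:E)%E.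
  move=> mh h0 ih.
  rewrite (ge0_integralD_EFin P mh mci h0 ci_ge0) ih.
  by rewrite (ge0_integralD_EFin P mcd mind (fun w => mulr_ge0 c0 (dev0 w)) ind0) icd iind.
have up : pn <= normal_cdf s x + (3 / (2 * m) * e + eps / 2).
  apply: (@le_trans _ _ (normal_cdf s x + (3 / (2 * m) * e + fine (P B)))); last first.
    by rewrite !lerD2l.
  rewrite -lee_fin -iQ -(isum (fun=> normal_cdf s x))//; last by case/andP: Phi01.
  apply: ge0_le_integral => //.
  - by move=> w _; rewrite lee_fin; have /andP[] := Q01 n x w.
  - exact/measurable_EFinP.
  - by apply/measurable_EFinP; exact: measurable_funD.
  - by move=> w _; rewrite lee_fin; have := pw w; rewrite ler_norml; lra.
have dn : normal_cdf s x <= pn + (3 / (2 * m) * e + eps / 2).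
  apply: (@le_trans _ _ (pn + (3 / (2 * m) * e + fine (P B)))); last first.
    by rewrite !lerD2l.
  rewrite -lee_fin -icst -(isum (fun w => fine (Q n x w)))//; last first.
    by move=> w; have /andP[] := Q01 n x w.
  apply: ge0_le_integral => //.
  - by move=> w _; rewrite lee_fin; case/andP: Phi01.
  - by apply/measurable_EFinP; exact: measurable_funD.
  - by move=> w _; rewrite lee_fin; have := pw w; rewrite ler_norml; lra.
have subP (E1 E2 : set T) : measurable E1 -> measurable E2 -> E1 `<=` E2 `|` B ->
    fine (P E1) <= fine (P E2) + fine (P B).
  move=> m1 m2 sub; rewrite -fineD ?fin_num_measure// fine_le ?fin_numD ?fin_num_measure//.
  apply: (@le_trans _ _ (P (E2 `|` B))); last exact: measureU2.
  by rewrite le_measure ?inE//; exact: measurableU.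
have mC : measurable [set w | window_sum alpha W Gamma (t 0%N) (t k) w <= x].
  have := measurable_window_sum alpha W Gamma (t 0%N) (t k) measurableT (measurable_itv `]-oo, x]).
  by rewrite setTI; congr measurable; apply/seteqP; split => z; rewrite /preimage/= in_itv.
have cE : cdf_window x = fine (P [set w | window_sum alpha W Gamma (t 0%N) (t k) w <= x]).
  suff -> : [set w | window_sum alpha W Gamma (t 0%N) (t k) w <= x] =
    window_sum alpha W Gamma (t 0%N) (t k) @^-1` `]-oo, x] by [].
  by apply/seteqP; split => z; rewrite /preimage/= in_itv.
have ppn : `|cdf_window x - pn| <= eps / 2.
  have h1 : cdf_window x <= pn + fine (P B).
    rewrite cE; apply: subP => // w /= ws; have [|nB] := pselect (B w); first by right.
    by left; have [_ G Nn] := notB w nB; rewrite /= -window_sumE.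
  have h2 : pn <= cdf_window x + fine (P B).
    rewrite cE; apply: subP => // w /= ws; have [|nB] := pselect (B w); first by right.
    by left; have [_ G Nn] := notB w nB; rewrite /= (window_sumE G Nn).
  by rewrite ler_norml; apply/andP; split; lra.
rewrite (_ : _ - _ = (cdf_window x - pn) + (pn - normal_cdf s x)); last by ring.
apply: (le_trans (ler_normD _ _)).
have : `|pn - normal_cdf s x| <= 3 / (2 * m) * e + eps / 2.
  by rewrite ler_norml; move: up dn; set E := 3 / _ * _; lra.
move: ppn; set E := 3 / _ * _; lra.
Qed.

End window_bound.

(** * Letting the mesh tend to 0 and the window grow *)

Section riemann_sums.
Context (R : realType).
Variables (phi Phi : R -> R) (t : nat -> R).
Hypotheses (t0 : 0 < t 0%N) (ti : forall i, t i < t i.+1).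
Hypothesis dPhi : forall x : R, 0 < x -> is_derive x 1 Phi (phi x).
Hypothesis phini : forall x y, t 0%N <= x -> x <= y -> phi y <= phi x.

Let t_ge i : t 0%N <= t i.
Proof. by elim: i => // i ih; rewrite (le_trans ih)// ltW. Qed.

Let cell i : phi (t i.+1) * (t i.+1 - t i) <= Phi (t i.+1) - Phi (t i) <=
  phi (t i) * (t i.+1 - t i).
Proof.
have x0 (x : R) : t i <= x -> 0 < x.
  by apply: lt_le_trans; exact: lt_le_trans (t_ge i).
have [||z] := @MVT R Phi phi _ _ (ti i).
- by move=> x; rewrite in_itv/= => /andP[/ltW/x0 + _]; exact: dPhi.
- apply: continuous_in_subspaceT => x; rewrite inE/= in_itv/= => /andP[/x0 xp _].
  apply: differentiable_continuous; apply/derivable1_diffP.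
  by case: (dPhi xp).
rewrite in_itv/= => /andP[tz zt] ->.
rewrite !ler_pM2r ?subr_gt0//; apply/andP; split; apply: phini; rewrite ?t_ge ?ltW//.
exact: le_lt_trans (t_ge i) tz.
Qed.

Lemma lower_riemann k :
  \sum_(i < k) phi (t i.+1) * (t i.+1 - t i) <= Phi (t k) - Phi (t 0%N).
Proof.
elim: k => [|k ih]; first by rewrite big_ord0 subrr.
by rewrite big_ord_recr/=; have /andP[+ _] := cell k; lra.
Qed.

Lemma upper_riemann k :
  Phi (t k) - Phi (t 0%N) <= \sum_(i < k) phi (t i) * (t i.+1 - t i).
Proof.
elim: k => [|k ih]; first by rewrite big_ord0 subrr.
by rewrite big_ord_recr/=; have /andP[_ +] := cell k; lra.
Qed.

(** On a uniform grid, shifting the index turns the upper sum into the lower one plus (phi (t 0) -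
    phi (t k)) h. *)
Lemma upper_riemann_le k (h : R) : 0 <= phi (t k) -> 0 <= h ->
    (forall i, t i.+1 - t i = h) ->
  \sum_(i < k) phi (t i) * (t i.+1 - t i) <=
    Phi (t k) - Phi (t 0%N) + phi (t 0%N) * h.
Proof.
move=> phik h0 th; rewrite -lerBlDr; apply: le_trans (lower_riemann k).
rewrite lerBlDr; under eq_bigr do rewrite th; under [in leRHS]eq_bigr do rewrite th.
rewrite -!mulr_suml -mulrDl ler_wpM2r//.
suff -> : \sum_(i < k) phi (t i) = \sum_(i < k) phi (t i.+1) + phi (t 0%N) - phi (t k) by lra.
by elim: k {phik} => [|k ih]; rewrite ?big_ord0 ?big_ord_recr/= ?ih; ring.
Qed.

End riemann_sums.

Section power_sums.
Context (R : realType).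

(** This antiderivative vanishes at +oo, so an integral over [c, D] is the tail from c minus the
    tail from D. *)
Lemma is_derive_powRN (p x : R) : 1 < p -> 0 < x ->
  is_derive x 1 (fun x => - ((p - 1)^-1 * x `^ (1 - p))) (x `^ (- p)).
Proof.
move=> p1 x0.
have -> : x `^ (- p) = - ((p - 1)^-1 *: ((1 - p) * x `^ (1 - p - 1))).
  have -> : 1 - p - 1 = - p by ring.
  by rewrite /GRing.scale/=; field; rewrite subr_eq0 gt_eqF.
apply: is_deriveN; apply: is_deriveZ; exact: is_derive1_powR.
Qed.

Lemma powRN_nonincreasing (p x y : R) : 0 < p -> 0 < x -> x <= y ->
  y `^ (- p) <= x `^ (- p).
Proof.
move=> p0 x0 xy; have y0 := lt_le_trans x0 xy.
rewrite !powRN lef_pV2 ?posrE ?powR_gt0//.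
by rewrite ge0_ler_powR ?nnegrE ?(ltW p0) ?(ltW x0) ?(ltW y0).
Qed.

Lemma sqr_powR (x r : R) : 0 < x -> (x `^ r) ^+ 2 = x `^ (2 * r).
Proof. by move=> x0; rewrite mulrC powRrM -powR_mulrn ?powR_ge0. Qed.

Lemma powRN_le_ev (p e : R) : 0 < p -> 0 < e ->
  exists2 D, 0 < D & forall x, D <= x -> x `^ (- p) <= e.
Proof.
move=> p0 e0; exists (e `^ (- p^-1)) => [|x ex]; first exact: powR_gt0.
apply: le_trans (powRN_nonincreasing p0 _ ex) _; first exact: powR_gt0.
by rewrite -powRrM mulrNN mulVf ?gt_eqF// powRr1// ltW.
Qed.

End power_sums.

Section window_limit.
Context d (T : measurableType d) (R : realType) (P : probability T R).
Variables (alpha sigma c : R) (W Gamma : nat -> {RV P >-> R}).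
Hypotheses (alpha0 : 0 < alpha) (alpha2 : alpha < 2) (sigma0 : 0 < sigma) (c0 : 0 < c).
Hypothesis GammaP : poisson_arrival_times 1 Gamma.
Hypothesis Ws : forall j, normally_distributed (W j) 0 sigma.
Hypothesis Wi : mutually_independent P (fun j => W j : T -> R).
Hypothesis WGi : independent_families P
  (fun j => W j : T -> R) (fun j => Gamma j : T -> R).

(** The squared weights are x^(-p); alpha < 2 makes p > 1, hence their integral up to +oo finite. *)
Let p := 2 / alpha.

Let p1 : 1 < p. Proof. by rewrite /p ltr_pdivlMr// mul1r. Qed.

(* [sigma ^+ 2 * tail_mean] and [sigma ^+ 4 * tail_var] are the mean and the
   variance of the conditional variance of the limit given [Gamma]. *)
Definition tail_mean := (p - 1)^-1 * c `^ (1 - p).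

Definition tail_var := (2 * p - 1)^-1 * c `^ (1 - 2 * p).

Let m := tail_mean.
Let v := tail_var.

Let m0 : 0 < m. Proof. by rewrite mulr_gt0 ?powR_gt0// invr_gt0 subr_gt0. Qed.

Let v0 : 0 < v. Proof. by rewrite mulr_gt0 ?powR_gt0// invr_gt0; move: p1; lra. Qed.

(** [F D] is the integral of x^(-p) over ]D, +oo[: m equals [F c], and the mean on the window ]c, D[
    is m - F D. *)
Let F (x : R) := (p - 1)^-1 * x `^ (1 - p).

(** The minimiser of v / (2 q) + q / 2, whose value there is sqrt v. *)
Let q := Num.sqrt v.

Let q0 : 0 < q. Proof. by rewrite sqrtr_gt0. Qed.

Let cdf_window D x := fine (cdf (window_sum alpha W Gamma c D : {RV P >-> R}) x).

Let A := c `^ (- p).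

(** The normal law has the variance of the infinite window whatever D is, at the price of the bias
    [F D]; the terms with h are discretisation errors. *)
Lemma window_grid_bound D k h x : c < D -> h = (D - c) / k.+1%:R ->
  `|cdf_window D x - normal_cdf (sigma * Num.sqrt m) x| <=
  3 / (2 * m) * ((v + A ^+ 2 * h + (F D + A * h) ^+ 2) / (2 * q) + q / 2 + A * h).
Proof.
move=> cD hE; have [N [NP GN]] := GammaP.
have h0 : 0 < h by rewrite hE divr_gt0// subr_gt0.
pose t i : R := c + i%:R * h.
have t0E : t 0%N = c by rewrite /t mul0r addr0.
have tkE : t k.+1 = D.
  by rewrite /t hE; field; rewrite nat1r pnatr_eq0.
have tS i : t i.+1 - t i = h by rewrite /t -natr1; ring.
have ti i : t i < t i.+1 by rewrite -subr_gt0 tS.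
have t0p : 0 < t 0%N by rewrite t0E.
have tge i : c <= t i by rewrite /t lerDl mulr_ge0// ltW.
have tp i : 0 < t i by exact: lt_le_trans (tge i).
pose f (y : R) := (y `^ (- alpha^-1)) ^+ 2.
have fE y : 0 < y -> f y = y `^ (- p).
  by move=> y0; rewrite /f sqr_powR//; congr (_ `^ _); rewrite /p; ring.
have f2E y : 0 < y -> f y ^+ 2 = y `^ (- (2 * p)).
  by move=> y0; rewrite fE// sqr_powR//; congr (_ `^ _); ring.
have p0 : 0 < p by move: p1; lra.
have f0 y : 0 <= f y by exact: sqr_ge0.
have fni y z : t 0%N <= y -> y <= z -> f z <= f y.
  rewrite t0E => cy yz; have y0 := lt_le_trans c0 cy; have z0 := lt_le_trans y0 yz.
  by rewrite !fE// powRN_nonincreasing.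
pose u := upper_weight f t; pose l := lower_weight f t k.+1.
have l0 i : 0 <= l i by exact: lower_weight_ge0.
have lu i : l i <= u i by exact: lower_upper_weight.
set SU := \sum_(i < k.+1) u i * (t i.+1 - t i).
set SV := \sum_(i < k.+1) u i ^+ 2 * (t i.+1 - t i).
set SL := \sum_(i < k.+1) l i * (t i.+1 - t i).
have dm := deviation_mean k.+1 NP (ltW t0p) ti l0 lu m0 q0.
have := window_bound alpha0 sigma0 m0 q0 t0p ti NP GN Ws Wi WGi x dm.
rewrite t0E tkE => /le_trans; apply.
rewrite ler_wpM2l//; first by rewrite divr_ge0// mulr_ge0// ltW.
rewrite -/SU -/SV -/SL.
(* The last lower weight being 0, the gaps between upper and lower weights telescope to exactly f (t
   0) = A. *)
have SULh : SU - SL = A * h.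
  have tele : \sum_(i < k) (f (t i) - f (t i.+1)) + f (t k) = f (t 0%N).
    by elim: (k) => [|i ih]; rewrite ?big_ord0 ?big_ord_recr/= -?ih; ring.
  rewrite /SU /SL -sumrB (eq_bigr (fun i : 'I_k.+1 => (u i - l i) * h)); last first.
    by move=> i _; rewrite -mulrBl tS.
  rewrite -mulr_suml big_ord_recr/= /A -fE// -t0E -tele; congr ((_ + _) * _).
    by apply: eq_bigr => i _; rewrite /u /l /upper_weight /lower_weight ltnS ltn_ord.
  by rewrite /u /l /upper_weight /lower_weight ltnn subr0.
have phini r : 0 < r -> forall y z, t 0%N <= y -> y <= z -> z `^ (- r) <= y `^ (- r).
  move=> r0 y z; rewrite t0E => cy yz; exact: powRN_nonincreasing (lt_le_trans c0 cy) yz.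
have SUle : - F D <= SU - m <= - F D + A * h.
  have SUE : SU = \sum_(i < k.+1) t i `^ (- p) * (t i.+1 - t i).
    by apply: eq_bigr => i _; rewrite /u /upper_weight fE.
  have := upper_riemann t0p ti (fun y => is_derive_powRN p1) (phini _ p0) k.+1.
  have := upper_riemann_le t0p ti (fun y => is_derive_powRN p1) (phini _ p0)
    (powR_ge0 _ _) (ltW h0) tS.
  move=> /(_ k.+1); rewrite -SUE t0E tkE -/(F D) -/(F c) -/A => h1 h2.
  have -> : m = F c by [].
  by apply/andP; split; lra.
have SVle : SV <= v + A ^+ 2 * h.
  have SVE : SV = \sum_(i < k.+1) t i `^ (- (2 * p)) * (t i.+1 - t i).
    by apply: eq_bigr => i _; rewrite /u /upper_weight f2E.
  have p21 : 1 < 2 * p by move: p1; lra.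
  have p20 : 0 < 2 * p by lra.
  have := upper_riemann_le t0p ti (fun y => is_derive_powRN p21) (phini _ p20)
    (powR_ge0 _ _) (ltW h0) tS.
  move=> /(_ k.+1); rewrite -SVE t0E tkE -/v => /le_trans; apply.
  have -> : c `^ (- (2 * p)) = A ^+ 2 by rewrite /A sqr_powR//; congr (_ `^ _); ring.
  rewrite lerD2r opprK addrC gerDl oppr_le0 mulr_ge0 ?powR_ge0// invr_ge0; lra.
have A0 : 0 <= A by exact: powR_ge0.
have FD0 : 0 <= F D by rewrite mulr_ge0 ?powR_ge0// invr_ge0; move: p1; lra.
have Ah0 : 0 <= A * h by rewrite mulr_ge0// ltW.
have SU2 : (SU - m) ^+ 2 <= (F D + A * h) ^+ 2.
  by rewrite -subr_ge0 subr_sqr mulr_ge0//; move: SUle; lra.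
rewrite SULh !lerD2r ler_wpM2r ?invr_ge0 ?mulr_ge0 ?(ltW q0)//.
by rewrite addrC lerD.
Qed.

Lemma window_bound_lim D x : c < D ->
  `|cdf_window D x - normal_cdf (sigma * Num.sqrt m) x| <=
  3 / (2 * m) * (q + F D ^+ 2 / (2 * q)).
Proof.
move=> cD; have A0 : 0 <= A by exact: powR_ge0.
have FD0 : 0 <= F D by rewrite mulr_ge0 ?powR_ge0// invr_ge0; move: p1; lra.
pose H := D - c; have H0 : 0 < H by rewrite subr_gt0.
(* The slope in h of the discretisation error, the quadratic term A^2 h^2 being bounded by A^2 h
   H. *)
pose C := 3 / (2 * m) * ((A ^+ 2 + 2 * F D * A + A ^+ 2 * H) / (2 * q) + A).
have c30 : 0 <= 3 / (2 * m) by rewrite divr_ge0// mulr_ge0// ltW.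
have q20 : 0 <= 2 * q by rewrite mulr_ge0// ltW.
have num0 : 0 <= A ^+ 2 + 2 * F D * A + A ^+ 2 * H.
  have FA : 0 <= F D * A by exact: mulr_ge0.
  have AH : 0 <= A ^+ 2 * H by rewrite mulr_ge0 ?sqr_ge0// ltW.
  by rewrite addr_ge0// addr_ge0 ?sqr_ge0// -mulrA mulr_ge0.
have C0 : 0 <= C by rewrite mulr_ge0// addr_ge0// divr_ge0.
apply/ler_addgt0Pr => e e0.
pose k := Num.truncn (C * H / e).
have hk : C * (H / k.+1%:R) <= e.
  by rewrite mulrA ler_pdivrMr// -ler_pdivrMl// mulrC ltW// truncnS_gt.
set h := H / _ in hk.
apply: (le_trans (window_grid_bound x cD (erefl h))).
have h0 : 0 <= h by rewrite divr_ge0// ltW.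
have hH : h <= H by rewrite /h ler_pdivrMr// ler_peMr ?(ltW H0)// ler1n.
have vq : v = q ^+ 2 by rewrite sqr_sqrtr// ltW.
apply: (@le_trans _ _ (3 / (2 * m) * (q + F D ^+ 2 / (2 * q)) + C * h)); last by rewrite lerD2l.
rewrite -subr_ge0.
have -> : 3 / (2 * m) * (q + F D ^+ 2 / (2 * q)) + C * h -
    3 / (2 * m) * ((v + A ^+ 2 * h + (F D + A * h) ^+ 2) / (2 * q) + q / 2 + A * h) =
    3 / (2 * m) * (A ^+ 2 * h * (H - h)) / (2 * q).
  by rewrite /C vq; field; rewrite !gt_eqF.
rewrite divr_ge0// mulr_ge0// mulr_ge0 ?subr_ge0//.
by rewrite mulr_ge0 ?sqr_ge0.
Qed.

Lemma cvg_window_bound (y : R) (l : \bar R) :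
    cdf (window_sum alpha W Gamma c D : {RV P >-> R}) y @[D --> +oo] --> l ->
    l \is a fin_num ->
  `|fine l - normal_cdf (sigma * Num.sqrt m) y| <= 3 / (2 * m) * q.
Proof.
move=> cl lfin; apply/ler_addgt0Pr => e e0.
pose e1 := e / 2; have e10 : 0 < e1 by rewrite divr_gt0.
have r0 : 0 < 3 / (2 * m) by rewrite divr_gt0// mulr_gt0.
have r1 : 0 < p - 1 by rewrite subr_gt0.
(* If F D <= min(1, r) then F D ^+ 2 <= r, where r is the size at which the bias costs e/2; the
   factor p - 1 cancels the coefficient in F. *)
pose e2 := Num.min 1 (e1 * (2 * q) / (3 / (2 * m))) * (p - 1).
have e1q : 0 < e1 * (2 * q) / (3 / (2 * m)).
  by apply: divr_gt0 => //; apply: mulr_gt0 => //; exact: mulr_gt0.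
have e20 : 0 < e2 by apply: mulr_gt0 => //; rewrite lt_min ltr01.
have [D0 D00 HD] := powRN_le_ev r1 e20.
move: cl; rewrite -(fineK lfin) => /fine_cvgP[_ /cvgrPdist_le /(_ _ e10)] [M [_ hM]].
pose D := Num.max (M + 1) (Num.max D0 (c + 1)).
have DM : M < D by rewrite lt_max ltrDl ltr01.
have DD0 : D0 <= D by rewrite le_max [X in _ || X]le_max lexx orbT.
have cD : c < D by rewrite !lt_max ltrDl ltr01 !orbT.
have {}hM := hM D DM; rewrite /= in hM.
have FD : F D <= Num.min 1 (e1 * (2 * q) / (3 / (2 * m))).
  have := HD D DD0; rewrite opprB /e2 /F => h.
  by rewrite mulrC ler_pdivrMr.
have FD0 : 0 <= F D by rewrite mulr_ge0 ?powR_ge0// invr_ge0 ltW.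
have FD2 : F D ^+ 2 <= e1 * (2 * q) / (3 / (2 * m)).
  move: FD; rewrite le_min => /andP[F1 F2].
  by apply: le_trans F2; rewrite expr2 ler_piMr.
have wb := window_bound_lim y cD.
have : 3 / (2 * m) * (q + F D ^+ 2 / (2 * q)) <= 3 / (2 * m) * q + e1.
  rewrite mulrDr lerD2l mulrA ler_pdivrMr ?mulr_gt0//.
  by rewrite mulrC -ler_pdivlMr.
move: wb hM; rewrite -/(cdf_window D y) => wb hM hE.
rewrite (_ : _ - _ = (fine l - cdf_window D y) +
  (cdf_window D y - normal_cdf (sigma * Num.sqrt m) y)); last by ring.
apply: (le_trans (ler_normD _ _)).
move: wb hM hE; rewrite /e1; set X := 3 / _ * _; set Y := 3 / _ * q; lra.
Qed.

End window_limit.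

(** * Distribution functions *)

Section continuity_points.
Context d (T : measurableType d) (R : realType) (P : probability T R).
Variable Y : {RV P >-> R}.

Let F x := fine (cdf Y x).

Let cdfE x : cdf Y x = (F x)%:E.
Proof. by rewrite /F fineK// fin_num_measure. Qed.

Let Fnd : nondecreasing_fun F.
Proof. by move=> x y xy; rewrite -lee_fin -!cdfE cdf_nondecreasing. Qed.

Lemma fine_cdf_right_continuous (x : R) : F y @[y --> x^'+] --> F x.
Proof.
have := @cdf_right_continuous _ _ _ P Y x.
by rewrite (cdfE x) => /fine_cvgP[_].
Qed.

(** A monotone function has countably many discontinuities, and an interval of positive length is
    not a null set. Convergence in distribution gives information at continuity points only, so
    these must be found in every interval. *)
Lemma cdf_continuity_point (a b : R) : a < b ->
  exists2 y, a < y < b & {for y, continuous (cdf Y)}.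
Proof.
move=> ab.
have ndab : {in `[a, b] &, nondecreasing_fun F} by move=> x y _ _; exact: Fnd.
have cD := discontinuity_countable ndab.
have [y yab nD] : exists2 y, a < y < b & ~ discontinuity F y.
  apply: contrapT => h.
  have : (@lebesgue_measure R) `]a, b[%classic = 0%E.
    apply: countable_lebesgue_measure0; apply: sub_countable cD; apply: subset_card_le.
    move=> x /= xab; split => //; apply: contrapT => nD; apply: h; exists x => //.
  by rewrite lebesgue_measure_itv/= lte_fin ab -EFinD => /eqP; rewrite eqe subr_eq0 gt_eqF.
exists y => //.
have Fl : cvg (F x @[x --> y^'-]).
  apply: nondecreasing_at_left_is_cvgr.
    by near=> z => u v _ _; exact: Fnd.
  by near=> z; exists (F y) => _ /= [u + <-]; rewrite in_itv/= => /andP[_ /ltW]; exact: Fnd.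
have Fr : F x @[x --> y^'+] --> F y by exact: fine_cdf_right_continuous.
have limr : lim (F x @[x --> y^'+]) = F y by apply/cvg_lim => //; exact: Rhausdorff.
have liml : lim (F x @[x --> y^'-]) = F y.
  rewrite -limr; apply: contrapT => /eqP ne; apply: nD; split => //.
  by apply/cvg_ex; exists (F y).
have cF : F x @[x --> y] --> F y.
  by apply/left_right_continuousP; split => //; rewrite -liml; exact: Fl.
rewrite /prop_for /continuous_at cdfE.
have -> : cdf Y = EFin \o F by apply/funext => x; rewrite /= cdfE.
by apply: cvg_EFin => //; exact: nearW.
Unshelve. all: by end_near. Qed.

End continuity_points.

Lemma normal_cdf_right_continuous (R : realType) (s : R) (x : R) : 0 < s ->
  normal_cdf s y @[y --> x^'+] --> normal_cdf s x.
Proof.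
move=> s0; apply/cvgrPdist_le => e e0.
have p0 : 0 < @normal_peak R 1 by rewrite normal_peak_gt0.
near=> y; have xy : x <= y by near: y; exact: nbhs_right_ge.
have yx : y <= x + e * s / normal_peak 1.
  by near: y; apply: nbhs_right_le; rewrite ltrDl divr_gt0// mulr_gt0.
have sc (z : R) : normal_cdf s z = normal_cdf 1 (s^-1 * z).
  by rewrite (normal_cdf_scale z (b := s^-1)) ?invr_gt0// mulVf// gt_eqF.
have xy' : s^-1 * x <= s^-1 * y by rewrite ler_wpM2l// invr_ge0 ltW.
have /andP[h1 h2] := normal_cdf_diff_le xy' (fun u _ => normal_pdf_ub 0 u (oner_neq0 R)).
rewrite distrC !sc ger0_norm//; apply: le_trans h2 _.
rewrite -mulrBr mulrCA ler_pdivrMl// -ler_pdivlMl//; lra.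
Unshelve. all: by end_near. Qed.

(** * Comparison of the constants *)

(** Squares are compared. Since pi <= 4 and 2 - delta <= 2, the right side is at least 1.44 eta / c;
    the left is 2.25 (2 - alpha)^2 / (alpha (4 - alpha) c). With eta = (2 - alpha) / alpha, this
    reduces to 144 (4 - alpha) >= 225 (2 - alpha). *)
Lemma tail_ratio_le (R : realType) (alpha c delta : R) :
    0 < alpha -> alpha < 2 -> 0 < c -> 0 < delta -> delta < 2 ->
  3 / (2 * tail_mean alpha c) * Num.sqrt (tail_var alpha c) <=
  96 / 10 * Num.sqrt (eta (alpha / 2)) / (pi * Num.sqrt (2 * (2 - delta) * c)).
Proof.
move=> alpha0 alpha2 c0 delta0 delta2.
have a1 : 0 < alpha / 2 by rewrite divr_gt0.
have a2 : 0 < 1 - alpha / 2 by rewrite subr_gt0 ltr_pdivrMr// mul1r.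
have e0 : 0 < eta (alpha / 2) by rewrite divr_gt0.
have d0 : 0 < 2 * (2 - delta) * c by apply: mulr_gt0 => //; lra.
have a4 : 0 < 4 - alpha by lra.
have d2 : 0 < 2 - delta by lra.
have pi4 : pi <= 4 :> R by have := pihalf_lt2 R; lra.
set M := tail_mean alpha c; set V := tail_var alpha c.
have p1 : 1 < 2 / alpha by rewrite ltr_pdivlMr// mul1r.
have M0 : 0 < M by rewrite mulr_gt0 ?powR_gt0// invr_gt0 subr_gt0.
have p2 : 0 < 2 * (2 / alpha) - 1 by lra.
have V0 : 0 < V by rewrite mulr_gt0 ?powR_gt0// invr_gt0.
have VM : V / M ^+ 2 = (2 - alpha) ^+ 2 / (alpha * (4 - alpha)) / c.
  rewrite /V /M /tail_var /tail_mean exprMn sqr_powR// invfM mulrACA -powRB; last first.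
    by rewrite (gt_eqF c0) implybT.
  (* The exponents of c cancel down to -1 whatever alpha is: this is the rate c^(-1/2) before the
     square root. *)
  have -> : 1 - 2 * (2 / alpha) - 2 * (1 - 2 / alpha) = -1 by ring.
  rewrite powR_inv1 ?(ltW c0)//; congr (_ * _); field.
  by rewrite !gt_eqF//; lra.
have LHS0 : 0 <= 3 / (2 * M) * Num.sqrt V.
  by rewrite mulr_ge0 ?sqrtr_ge0// divr_ge0// mulr_ge0// ltW.
have RHS0 : 0 <= 96 / 10 * Num.sqrt (eta (alpha / 2)) / (pi * Num.sqrt (2 * (2 - delta) * c)).
  by rewrite divr_ge0 ?mulr_ge0 ?sqrtr_ge0 ?pi_ge0.
rewrite -ler_sqr ?nnegrE// [leLHS]exprMn [leRHS]exprMn [X in _ <= X * _]exprMn.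
rewrite [X in X * _]exprMn !exprVn [(pi * _) ^+ 2]exprMn [(2 * M) ^+ 2]exprMn.
rewrite !sqr_sqrtr ?(ltW V0) ?(ltW e0) ?(ltW d0)//.
have -> : 3 ^+ 2 / (2 ^+ 2 * M ^+ 2) * V = 9 / 4 * (V / M ^+ 2).
  by field; rewrite gt_eqF.
apply: (@le_trans _ _ ((96 / 10) ^+ 2 * eta (alpha / 2) / (16 * (4 * c)))).
  rewrite VM -subr_ge0.
  have -> : (96 / 10) ^+ 2 * eta (alpha / 2) / (16 * (4 * c)) -
      9 / 4 * ((2 - alpha) ^+ 2 / (alpha * (4 - alpha)) / c) =
      (2 - alpha) * (144 * (4 - alpha) - 225 * (2 - alpha)) / (100 * (alpha * (4 - alpha) * c)).
    by rewrite /eta; field; rewrite !gt_eqF//; lra.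
  by rewrite divr_ge0// !mulr_ge0//; lra.
rewrite ler_wpM2l//; first by rewrite mulr_ge0 ?sqr_ge0// ltW.
rewrite lef_pV2 ?posrE ?mulr_gt0 ?exprn_gt0 ?pi_gt0//.
apply: ler_pM; rewrite ?sqr_ge0 ?(ltW d0)//.
- rewrite (_ : 16 = 4 ^+ 2); last by rewrite -natrX.
  by rewrite ler_sqr ?nnegrE ?pi_ge0.
- by rewrite ler_wpM2r ?(ltW c0)//; lra.
Qed.

Lemma S_tailE (R : realType) (sigma alpha c : R) :
    0 < sigma -> 0 < alpha -> alpha < 2 ->
  S_tail sigma alpha c = sigma * Num.sqrt (tail_mean alpha c).
Proof.
move=> s0 a0 a2; rewrite /S_tail /S2_tail -mulrA sqrtrM ?sqr_ge0// sqrtr_sqr gtr0_norm//.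
congr (_ * Num.sqrt _); rewrite /tail_mean; congr (_ * _ `^ _); field.
  by rewrite !gt_eqF//; lra.
by rewrite gt_eqF.
Qed.

(** * From continuity points to the Kolmogorov distance *)

Unset Implicit Arguments.
Set Strict Implicit.

Theorem theorem4 (R : realType)
    (d1 d2 d3 : measure_display)
    (T1 : measurableType d1) (P1 : probability T1 R)
    (T2 : measurableType d2) (P2 : probability T2 R)
    (T3 : measurableType d3) (P3 : probability T3 R)
    (alpha sigma c delta : R)
    (Gamma W : nat -> {RV P1 >-> R}) (Rc : {RV P2 >-> R}) (Z : {RV P3 >-> R})
    (alpha_gt0 : 0 < alpha) (alpha_lt2 : alpha < 2) (alpha_neq1 : alpha != 1)
    (sigma_gt0 : 0 < sigma) (c_gt1 : 1 < c)
    (delta_gt0 : 0 < delta) (delta_lt2 : delta < 2)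
    (GammaP : poisson_arrival_times 1 Gamma)
    (W_normal : forall j, normally_distributed (W j) 0 sigma)
    (W_indep : mutually_independent P1 (fun j => W j : T1 -> R))
    (W_Gamma_indep : independent_families P1
       (fun j => W j : T1 -> R) (fun j => Gamma j : T1 -> R))
    (Rc_lim : cvg_in_distribution
       (fun d : R => window_sum alpha W Gamma c d : {RV P1 >-> R}) Rc)
    (Z_normal : normally_distributed Z 0 1) :
  (kolmogorov_distance
     ((S_tail sigma alpha c)^-1 \o* Rc : {RV P2 >-> R}) Z
     <= (B2 c alpha delta)%:E)%E /\
  (fun x : R => B3 x alpha delta) =O_ (+oo%R) (fun x : R => x^-1).
Proof.
split; last exact: B3_bigO.
have c0 : 0 < c by exact: lt_trans c_gt1.
set s := S_tail sigma alpha c.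
have sE : s = sigma * Num.sqrt (tail_mean alpha c) by exact: S_tailE.
have m0 : 0 < tail_mean alpha c.
  by rewrite mulr_gt0 ?powR_gt0// invr_gt0 subr_gt0 ltr_pdivlMr// mul1r.
have s0 : 0 < s by rewrite sE mulr_gt0// sqrtr_gt0.
have cdf_fin d (T : measurableType d) (P : probability T R) (Y : {RV P >-> R}) y :
    cdf Y y = (fine (cdf Y y))%:E.
  by rewrite fineK// fin_num_measure.
suff main y : `|fine (cdf Rc y) - normal_cdf s y| <= B2 c alpha delta.
  apply: ge_ereal_sup => _ /= [x _ <-].
  have -> : cdf ((S_tail sigma alpha c)^-1 \o* Rc : {RV P2 >-> R}) x = cdf Rc (s * x).
    suff e : (s^-1 \o* Rc) @^-1` `]-oo, x] = Rc @^-1` `]-oo, s * x].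
      by rewrite /cdf /distribution /pushforward; congr (P2 _).
    by apply/seteqP; split => w; rewrite /preimage/= !in_itv/= ler_pdivrMr// mulrC.
  have -> : cdf Z x = (normal_cdf s (s * x))%:E.
    rewrite /cdf Z_normal// normal_cdfE (normal_cdf_scale x (b := s))// ?mulr1//.
  by rewrite cdf_fin -EFinB lee_fin.
apply: (@le_trans _ _ (3 / (2 * tail_mean alpha c) * Num.sqrt (tail_var alpha c))); last first.
  apply: (le_trans (tail_ratio_le alpha_gt0 alpha_lt2 c0 delta_gt0 delta_lt2)).
  by rewrite /B2 lerDl B3_ge0.
(* The distribution function of [Rc] may jump at y. The bound is taken at a continuity point z
   slightly to the right, where right-continuity keeps both distribution functions within e/2 of
   their values at y. *)
apply/ler_addgt0Pr => e e0.
have e20 : 0 < e / 2 by rewrite divr_gt0.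
have /cvgrPdist_le /(_ _ e20) nF := @fine_cdf_right_continuous _ _ _ P2 Rc y.
have /cvgrPdist_le /(_ _ e20) nN := @normal_cdf_right_continuous R s y s0.
have [r /= r0 hr] := filterI nF nN.
have [z /andP[yz zr] cz] := @cdf_continuity_point _ _ _ P2 Rc y (y + r) (ltac:(by rewrite ltrDl)).
have [|h1 h2] := hr z _ yz.
  by rewrite /= ltr0_norm ?subr_lt0// opprB ltrBlDl.
have zfin : cdf Rc z \is a fin_num by rewrite fin_num_measure.
have := @cvg_window_bound _ _ _ P1 alpha sigma c W Gamma alpha_gt0 alpha_lt2 sigma_gt0 c0
  GammaP W_normal W_indep W_Gamma_indep z (cdf Rc z) (Rc_lim z cz) zfin.
rewrite -sE; set B := 3 / _ * _ => h3.
rewrite (_ : _ - _ = (fine (cdf Rc y) - fine (cdf Rc z)) +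
  (fine (cdf Rc z) - normal_cdf s z) + (normal_cdf s z - normal_cdf s y)); last by ring.
rewrite (le_trans (ler_normD _ _))// (le_trans (lerD (ler_normD _ _) (lexx _)))//.
rewrite (distrC (normal_cdf s z)); lra.
Qed.
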